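(* Let $K\in\mathcal{P}(m,n)$, where $m\ge 4$ and $3\le n\le m$, and let $A$ be a $K$-primitive matrix. Let $m_A$ be the degree of the minimal polynomial of $A$. Below, ''the digraph'' means $(\mathcal{E},\mathcal{P}(A,K))$, and ''is given by'' means ''is isomorphic to''. Then: (i) $\gamma(A)\le (m_A-1)(m-1)+1$, where equality holds only if the digraph is given by $F_1$, in which case $\gamma(A)=(n-1)(m-1)+1$. (ii) $\gamma(A)=(m_A-1)(m-1)$ only if either the digraph is given by $F_1$ or $F_2$, in which case $\gamma(A)=(n-1)(m-1)$, or $m_A=3$. (iii) $\gamma(A)=(m_A-1)(m-2)+2$ only if $m_A\ge 3$ and the digraph is given by one of the following: $F_1$, $F_2$, $F_3$, $F_4$ or $F_5$; or a digraph obtained from $F_5$ by deleting any one or two of the three arcs $(x_{m-1},x_1)$, $(x_m,x_1)$, $(x_m,x_2)$; or a digraph obtained from $F_3$ with $m=4$ by adding the arc $(x_3,x_1)$ or by substituting it for the arc $(x_4,x_1)$. (iv) If $m_A=2$, or if the digraph is not given by any of $F_1,\ldots,F_5$, nor by a digraph derived from $F_5$ or from $F_3$ (with $m=4$) in the way described in (iii), then $\gamma(A)\le (m_A-1)(m-2)+1$.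
   Context: A proper cone $K$ in $\mathbb{R}^n$ is a closed convex cone that is pointed ($K\cap(-K)=\{0\}$) and has nonempty interior. A face of $K$ is a subcone $F\subseteq K$ such that $y\in F$ whenever $x\in F$ and $y,x-y\in K$. For $x\in K$, $\Phi(x)$ is the smallest face of $K$ containing $x$. A nonzero $x\in K$ is an extreme vector if $\Phi(x)=\{\lambda x:\lambda\ge0\}$, which is then an extreme ray. A polyhedral cone is a proper cone with finitely many extreme rays; $\mathcal{P}(m,n)$ is the set of $n$-dimensional polyhedral cones with exactly $m$ extreme rays. $\pi(K)$ is the set of real matrices $A$ with $AK\subseteq K$. $A\in\pi(K)$ is $K$-primitive if $A^p(K\setminus\{0\})\subseteq\operatorname{int}K$ for some positive integer $p$; the least such $p$ is the exponent $\gamma(A)$. For $A\in\pi(K)$, $(\mathcal{E},\mathcal{P}(A,K))$ is the digraph whose vertices are the extreme rays of $K$, with an arc $(\Phi(x),\Phi(y))$ whenever $\Phi(y)\subseteq\Phi(Ax)$. The following digraphs are on the vertices $x_1,\ldots,x_m$. $F_1$ has arcs $x_i\to x_{i+1}$ ($1\le i\le m-1$), $x_m\to x_1$ and $x_m\to x_2$. $F_2$ is $F_1$ together with the arc $x_1\to x_3$. Let $B$ be the digraph with arcs $x_i\to x_{i+1}$ ($1\le i\le m-1$) and $x_m\to x_3$. $F_3$ is $B$ together with the arcs $x_m\to x_1$ and $x_2\to x_4$. $F_4$ is $B$ together with the arcs $x_{m-1}\to x_1$ and $x_2\to x_m$. $F_5$ is $B$ together with the arcs $x_{m-1}\to x_1$,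 $x_m\to x_1$ and $x_m\to x_2$. *)

(* Defs.v *)
From HB Require Import structures.
From mathcomp Require Import all_boot all_order all_algebra.
From mathcomp Require Import all_classical all_reals.
From mathcomp Require Import topology normedtype.
Set Implicit Arguments.
Unset Strict Implicit.
Unset Printing Implicit Defensive.
Import Order.TTheory GRing.Theory Num.Theory.
Import numFieldNormedType.Exports.
Local Open Scope classical_set_scope.
Local Open Scope card_scope.
Local Open Scope ring_scope.

Section Cones.
Variables (R : realType) (n : nat).
Implicit Types (K F E : set 'cV[R]_n) (A : 'M[R]_n) (x y : 'cV[R]_n).

Definition convex_cone K : Prop :=
  K !=set0 /\
  forall (a b : R) x y, 0 <= a -> 0 <= b -> K x -> K y -> K (a *: x + b *: y).

Definition proper_cone K : Prop :=
  [/\ convex_cone K, closed K, K `&` [set - x | x in K] = [set 0]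
    & K° !=set0].

Definition face K F : Prop :=
  [/\ convex_cone F, F `<=` K
    & forall x y, F x -> K y -> K (x - y) -> F y].

Definition Phi K x : set 'cV[R]_n := smallest (face K) [set x].

Definition extreme_vector K x : Prop :=
  [/\ K x, x != 0 & Phi K x = [set l *: x | l in [set l : R | 0 <= l]]].

Definition extreme_rays K : set (set 'cV[R]_n) :=
  [set Phi K x | x in extreme_vector K].

(* The class P(m, n); the dimension n is that of the ambient space, in which K
   has nonempty interior. *)
Definition polyhedral_cone (m : nat) K : Prop :=
  proper_cone K /\ extreme_rays K #= `I_m.

Definition cone_preserving K A : Prop := forall x, K x -> K (A *m x).

Definition power_positive K A (p : nat) : Prop :=
  (0 < p)%N /\ forall x, K x -> x != 0 -> K° (A ^+ p *m x).

Definition primitive K A : Prop :=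
  cone_preserving K A /\ exists p : nat, power_positive K A p.

(* The least p witnessing primitivity; the value is 0 if A is not primitive. *)
Definition gamma K A : nat :=
  xget 0%N [set p | power_positive K A p /\
                    forall q, power_positive K A q -> (p <= q)%N].

Definition ray_arc K A E F : Prop :=
  exists x y, [/\ extreme_vector K x, extreme_vector K y,
    E = Phi K x, F = Phi K y & Phi K y `<=` Phi K (A *m x)].

(* A digraph on x_1, ..., x_m is encoded by the list D of its arcs, (i, j)
   standing for x_i -> x_j; the vertex x_k is the element k - 1 of 'I_m. *)
Definition digraph_given_by (m : nat) K A (D : seq (nat * nat)) : Prop :=
  exists f : 'I_m -> set 'cV[R]_n,
    set_bij [set: 'I_m] (extreme_rays K) f /\
    forall i j : 'I_m, ray_arc K A (f i) (f j) <-> (i.+1, j.+1) \in D.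

End Cones.

Section Digraphs.
Local Open Scope nat_scope.
Local Open Scope seq_scope.
Implicit Types (m : nat) (D : seq (nat * nat)).

Definition path_arcs m : seq (nat * nat) :=
  [seq (i, i.+1) | i <- iota 1 (m - 1)].

Definition F1 m := path_arcs m ++ [:: (m, 1); (m, 2)].
Definition F2 m := F1 m ++ [:: (1, 3)].
Definition B m := path_arcs m ++ [:: (m, 3)].
Definition F3 m := B m ++ [:: (m, 1); (2, 4)].
Definition F4 m := B m ++ [:: (m - 1, 1); (2, m)].
Definition F5 m := B m ++ [:: (m - 1, 1); (m, 1); (m, 2)].

Definition delete_arcs (s D : seq (nat * nat)) := [seq a <- D | a \notin s].

Definition F5_deleted m D : Prop :=
  exists s, [/\ subseq s [:: (m - 1, 1); (m, 1); (m, 2)], 1 <= size s <= 2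
              & D = delete_arcs s (F5 m)].

Definition F3_modified m D : Prop :=
  m = 4 /\ (D = F3 m ++ [:: (3, 1)] \/
            D = delete_arcs [:: (4, 1)] (F3 m) ++ [:: (3, 1)]).

Definition listed_digraph m D : Prop :=
  D \in [:: F1 m; F2 m; F3 m; F4 m; F5 m] \/ F5_deleted m D \/ F3_modified m D.

End Digraphs.

(* Main.v *)
(* Write [y << x] when [t x - y] lies in K for some t > 0, i.e. when y is in the
   face of x, and let d be the degree of the minimal polynomial of A.  If a closed
   walk of length l passes through the extreme ray of x, the faces of the vectors
   A^(l k) x increase with k; the powers of A^l are combinations of the first d of
   them, and some A^(l p) x is interior, so A^((d - 1) l) x is interior already.
   Hence A^N can fail to map the extreme vector y into the interior of K only if
   N < (d - 1) l + k for every closed walk of length l starting at distance k from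
   y.  As the shortest way from y into a shortest circuit reachable from y consists
   of k + l <= m distinct vertices, N > (d - 1)(m - 2) and d >= 3 force l >= m - 2, and the
   remaining digraphs are few enough to be enumerated.  In F1 and F2 the matrix A has
   a cyclic vector, whence d = n.  If d = 2, the exponent is at most 2. *)
Require Import Defs.
From HB Require Import structures.
From mathcomp Require Import all_boot all_order all_algebra.
From mathcomp Require Import all_classical all_reals.
From mathcomp Require Import topology normedtype.
From mathcomp Require Import zify.
Local Open Scope classical_set_scope.
Local Open Scope ring_scope.

(** * Faces of a cone *)

Section ConeOrder.
Set Implicit Arguments.
Unset Strict Implicit.
Import Order.TTheory GRing.Theory Num.Theory.
Import numFieldNormedType.Exports.
Variables (R : realType) (n : nat) (K : set 'cV[R]_n).
Implicit Types (x y z u v : 'cV[R]_n) (t c : R) (s : seq 'cV[R]_n).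

(** The vector [y] is not asked to lie in [K], so that negative multiples of vectors of [K] are
    covered too. *)
Definition dominated x y := exists2 t, 0 < t & K (t *: x - y).

Lemma near_line (B : set 'cV[R]_n) x y :
  nbhs x B -> exists2 e : R, 0 < e & forall t, `|t| < e -> B (x + t *: y).
Proof.
move=> Bx.
have cvgf : (fun t : R => x + t *: y) @ (0 : R) --> x + 0 *: y.
  apply: cvgD; first exact: cvg_cst.
  by apply: cvgZr_tmp; exact: cvg_id.
rewrite scale0r addr0 in cvgf.
have /nbhs_ballP [e /= e0 He] := cvgf _ Bx; exists e => // t te.
by apply: He; rewrite /ball /= sub0r normrN.
Qed.

Lemma closed_line x y : closed K ->
  (forall e : R, 0 < e -> exists2 t, `|t| < e & K (x + t *: y)) -> K x.
Proof.
move=> clK H; apply: clK => B /near_line -/(_ y) [e e0 He].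
by have [t te Kt] := H e e0; exists (x + t *: y); split=> //; exact: He.
Qed.

Lemma interiorP x :
  K° x <-> exists2 e : R, 0 < e & forall v, `|x - v| < e -> K v.
Proof.
split=> [/nbhs_ballP [e e0 He]|[e e0 He]].
  by exists e => // v xv; apply: He; rewrite -ball_normE.
by apply/nbhs_ballP; exists e => // v; rewrite -ball_normE; exact: He.
Qed.

Hypothesis coneK : convex_cone K.

Lemma coneD x y : K x -> K y -> K (x + y).
Proof. by move=> Kx Ky; have := coneK.2 1 1 x y; rewrite !scale1r; apply. Qed.

Lemma cone0 : K 0.
Proof.
have [x Kx] := coneK.1; have := coneK.2 0 0 x x; rewrite !scale0r addr0.
by apply.
Qed.

Lemma coneZ c x : 0 <= c -> K x -> K (c *: x).
Proof.
by move=> c0 Kx; have := coneK.2 c 0 x 0; rewrite scaler0 addr0; apply=> //;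
  exact: cone0.
Qed.

Lemma cone_sum s : (forall v, v \in s -> K v) -> K (\sum_(v <- s) v).
Proof.
elim: s => [|v s IHs] Ks; first by rewrite big_nil; exact: cone0.
rewrite big_cons; apply: coneD; first by apply: Ks; rewrite mem_head.
by apply: IHs => w ws; apply: Ks; rewrite in_cons ws orbT.
Qed.

Lemma dominated_refl x : dominated x x.
Proof. by exists 1 => //; rewrite scale1r subrr; exact: cone0. Qed.

Lemma dominated_trans y x z : dominated x y -> dominated y z -> dominated x z.
Proof.
move=> [t t0 Kt] [c c0 Kc]; exists (c * t); first exact: mulr_gt0.
have -> : (c * t) *: x - z = c *: (t *: x - y) + (c *: y - z).
  by rewrite scalerBr scalerA addrA subrK.
by apply: coneD => //; apply: coneZ => //; exact: ltW.
Qed.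

Lemma dominatedZr c x y : 0 <= c -> K x -> dominated x y -> dominated x (c *: y).
Proof.
move=> c0 Kx [t t0 Kt]; exists (c * t + 1).
  by rewrite ltr_wpDl // mulr_ge0 // ltW.
rewrite scalerDl scale1r -scalerA addrAC -scalerBr.
by apply: coneD => //; exact: coneZ.
Qed.

(** For [c < 0] the vector [- c *: y] lies in [K]. Hence the signs of the coefficients do not matter
    when a linear combination is to be dominated. *)
Lemma dominatedZ c x y : K x -> K y -> dominated x y -> dominated x (c *: y).
Proof.
move=> Kx Ky xy; have [c0|c0] := leP 0 c; first exact: dominatedZr.
exists 1 => //; rewrite scale1r -scaleNr; apply: coneD => //.
by apply: coneZ => //; rewrite oppr_ge0 ltW.
Qed.

Lemma dominatedDr x y z : dominated x y -> dominated x z -> dominated x (y + z).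
Proof.
move=> [t t0 Kt] [c c0 Kc]; exists (t + c); first exact: addr_gt0.
by rewrite scalerDl opprD addrACA; exact: coneD.
Qed.

Lemma dominated0 x : K x -> dominated x 0.
Proof. by exists 1 => //; rewrite subr0 scale1r. Qed.

Lemma dominatedZl c x y : 0 < c -> dominated x y -> dominated (c *: x) y.
Proof.
move=> c0 [t t0 Kt]; exists (t / c); first exact: divr_gt0.
by rewrite scalerA divfK // lt0r_neq0.
Qed.

Lemma dominated_subl x y : K (x - y) -> dominated x y.
Proof. by exists 1 => //; rewrite scale1r. Qed.

(** The right-hand side is a face containing [x]. Conversely, a face containing [x] contains
    [t *: x], hence every [y] of [K] with [t *: x - y] in [K]. *)
Lemma PhiE x : K x -> Phi K x = [set y | K y /\ dominated x y].
Proof.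
move=> Kx; rewrite eqEsubset; split=> y.
  move=> Hy; suff : face K [set y | K y /\ dominated x y] /\
      [set x] `<=` [set y | K y /\ dominated x y] by apply: Hy.
  split; last by move=> z ->; split=> //; exact: dominated_refl.
  split.
  - split; first by exists x; split => //; exact: dominated_refl.
    move=> a b z w a0 b0 [Kz xz] [Kw xw]; split; first exact: coneK.2.
    by apply: dominatedDr; exact: dominatedZr.
  - by move=> z [].
  - move=> z w [Kz xz] Kw Kzw; split=> //.
    by apply: dominated_trans xz _; exact: dominated_subl.
move=> [Ky [t t0 Kt]] F [[coneF FK faceF] xF].
apply: (faceF (t *: x)) => //.
have Fx : F x by exact: xF.
have F0 : F 0.
  by have := coneF.2 0 0 x x; rewrite !scale0r addr0; apply.
by have := coneF.2 t 0 x 0; rewrite scaler0 addr0; apply=> //; exact: ltW.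
Qed.

Lemma PhiZ c x : 0 < c -> K x -> Phi K (c *: x) = Phi K x.
Proof.
move=> c0 Kx; have Kcx : K (c *: x) by apply: coneZ => //; exact: ltW.
rewrite !PhiE //; apply/seteqP; split=> y [Ky yx]; split=> //.
  rewrite -(scalerK (lt0r_neq0 c0) x).
  by apply: dominatedZl => //; rewrite invr_gt0.
exact: dominatedZl.
Qed.

Lemma sub_Phi x y : K x -> K y -> (Phi K y `<=` Phi K x) <-> dominated x y.
Proof.
move=> Kx Ky; rewrite !PhiE //; split.
  by move=> /(_ y) [] //; split=> //; exact: dominated_refl.
by move=> xy z [Kz yz]; split=> //; exact: dominated_trans xy yz.
Qed.

Lemma interiorD x y : K° x -> K y -> K° (x + y).
Proof.
move=> /interiorP [e e0 He] Ky; apply/interiorP; exists e => // v xyv.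
by rewrite -(subrK y v); apply: coneD => //; apply: He; rewrite opprB addrA.
Qed.

Lemma interiorZ c x : 0 < c -> K° x -> K° (c *: x).
Proof.
move=> c0 /interiorP [e e0 He]; apply/interiorP.
exists (c * e) => [|v cxv]; first exact: mulr_gt0.
have cn0 : c != 0 by rewrite gt_eqF.
rewrite -[v](scalerKV cn0); apply: coneZ => //; first exact: ltW.
apply: He; rewrite -(ltr_pM2l c0) -{1}(gtr0_norm c0) -normrZ scalerBr.
by rewrite scalerKV.
Qed.

Lemma dominated_interior x y : K° x -> dominated y x -> K° y.
Proof.
move=> Kx [t t0 Kt]; have tn0 : t != 0 by rewrite gt_eqF.
rewrite -[y](scalerK tn0); apply: interiorZ; first by rewrite invr_gt0.
by rewrite -(subrK x (t *: y)) addrC; exact: interiorD.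
Qed.

Lemma interior_dominated x y : K° x -> dominated x y.
Proof.
move=> /near_line -/(_ (- y)) [e e0 He].
exists (e / 2)^-1; first by rewrite invr_gt0 divr_gt0.
have e20 : 0 < e / 2 by rewrite divr_gt0.
have -> : (e / 2)^-1 *: x - y = (e / 2)^-1 *: (x + (e / 2) *: (- y)).
  by rewrite scalerDr scalerK ?gt_eqF.
apply: coneZ; first by rewrite invr_ge0 ltW.
by apply: He; rewrite gtr0_norm // ltr_pdivrMr // ltr_pMr // ltr1n.
Qed.

End ConeOrder.

(** * Generation of a proper cone by its extreme vectors *)

Section Minkowski.
Set Implicit Arguments.
Unset Strict Implicit.
Import Order.TTheory GRing.Theory Num.Theory.
Import numFieldNormedType.Exports.
Variables (R : realType) (n : nat) (K : set 'cV[R]_n).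
Implicit Types (x y z u v : 'cV[R]_n) (t c : R) (s : seq 'cV[R]_n).
Hypothesis properK : proper_cone K.

Let coneK : convex_cone K. Proof. by case: properK. Qed.
Let closedK : closed K. Proof. by case: properK. Qed.

Lemma pointed x : K x -> K (- x) -> x = 0.
Proof.
move=> Kx KNx; case: properK => _ _ pK _.
have : (K `&` [set - y | y in K]) x by split=> //; exists (- x); rewrite ?opprK.
by rewrite pK.
Qed.

Lemma coneD_eq0 x y : K x -> K y -> x + y = 0 -> x = 0.
Proof.
by move=> Kx Ky /eqP; rewrite addr_eq0 => /eqP xy; apply: pointed => //;
  rewrite xy opprK.
Qed.

(** The largest [t] with [x - t *: y] in [K] works: if [y] were still dominated, more of it could be
    subtracted. *)
Lemma subtract_maximal x y : K x -> K y -> y != 0 ->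
  exists2 t, 0 <= t & K (x - t *: y) /\ ~ dominated K (x - t *: y) y.
Proof.
move=> Kx Ky y0; pose S := [set t | 0 <= t /\ K (x - t *: y)].
have S0 : S 0 by split=> //; rewrite scale0r subr0.
have supS : has_sup S.
  split; first by exists 0.
  (* If [t] were unbounded, the vectors [t^-1 *: (x - t *: y)] of [K] would tend to [- y], against
     pointedness. *)
  apply: contrapT => unbS; case/eqP: y0; apply: pointed => //.
  apply: (@closed_line _ _ _ _ x) => // e e0.
  have [t /not_implyP [[t0 St] /negP]] : exists t, ~ (S t -> t <= e^-1 + 1).
    by apply/existsNP => H; apply: unbS; exists (e^-1 + 1).
  rewrite -ltNge => et; have tgt0 : 0 < t.
    by apply: le_lt_trans et; rewrite addr_ge0 // invr_ge0 ltW.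
  exists t^-1.
    rewrite gtr0_norm ?invr_gt0 // invf_plt ?posrE //.
    by apply: le_lt_trans et; rewrite lerDl.
  have -> : - y + t^-1 *: x = t^-1 *: (x - t *: y).
    by rewrite scalerBr scalerK ?gt_eqF // addrC.
  by apply: (coneZ coneK) => //; rewrite invr_ge0.
have S_le t : S t -> t <= sup S by exact/ub_le_sup/supS.2.
exists (sup S); first exact: S_le.
have KS : K (x - sup S *: y).
  apply: (@closed_line _ _ _ _ y) => // e e0.
  have [t St te] := sup_adherent e0 supS; exists (sup S - t).
    by rewrite ger0_norm ?subr_ge0 ?S_le // ltrBlDr -ltrBlDl.
  by rewrite scalerBl addrA subrK; exact: St.2.
split=> // -[t t0 Kt].
have : S (sup S + t^-1).
  split; first by rewrite addr_ge0 ?S_le // invr_ge0 ltW.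
  rewrite scalerDl opprD addrA.
  have -> : x - sup S *: y - t^-1 *: y = t^-1 *: (t *: (x - sup S *: y) - y).
    by rewrite scalerBr scalerK ?gt_eqF.
  by apply: (coneZ coneK) => //; rewrite invr_ge0 ltW.
by move=> /S_le; rewrite gerDl leNgt invr_gt0 t0.
Qed.

Lemma dominated_span x y s : K x -> (forall v, v \in s -> K v /\ dominated K x v) ->
  y \in <<s>>%VS -> dominated K x y.
Proof.
move=> Kx Ks /(@coord_span _ _ _ (in_tuple s)) ->.
apply: (big_ind (dominated K x)) => [|u v|i _]; first exact: dominated0.
- exact: (dominatedDr coneK).
set c := coord _ _ _; have [Kv xv] : K s`_i /\ dominated K x s`_i.
  by apply: Ks; exact: mem_nth.
exact: (dominatedZ coneK).
Qed.

Lemma extreme_vectorZ c x : 0 < c -> extreme_vector K x ->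
  extreme_vector K (c *: x).
Proof.
move=> c0 [Kx x0 Hx]; have Kcx : K (c *: x) by exact/(coneZ coneK)/Kx/ltW.
split=> //; first by rewrite scaler_eq0 negb_or x0 gt_eqF.
rewrite (PhiZ coneK) // Hx; apply/seteqP; split=> _ [l /= l0 <-].
  by exists (l / c); rewrite ?scalerA ?divfK ?gt_eqF //= divr_ge0 // ltW.
by exists (l * c); rewrite ?scalerA //= mulr_ge0 // ltW.
Qed.

Lemma extreme_dominated x y : extreme_vector K x -> K y -> dominated K x y ->
  y != 0 -> exists2 c, 0 < c & y = c *: x.
Proof.
move=> [Kx _ Hx] Ky xy y0; have : Phi K x y by rewrite PhiE.
rewrite Hx => -[c /= c0 cE]; exists c => //; rewrite lt_neqAle c0 andbT eq_sym.
by apply: contra_neq y0 => c_eq0; rewrite -cE c_eq0 scale0r.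
Qed.

(* Induction on the largest number of independent vectors in the face of [x]:
   if [x] is not extreme, it is the sum of two vectors whose faces miss a vector
   of the face of [x]. *)
Lemma Minkowski x : K x -> exists2 s, x = \sum_(v <- s) v &
  forall v, v \in s -> extreme_vector K v.
Proof.
have [k] : exists k, forall s, (forall v, v \in s -> K v /\ dominated K x v) ->
    free s -> (size s <= k)%N.
  exists (\dim {:'cV[R]_n}) => s _ /eqP <-; exact/dimvS/subvf.
elim: k x => [|k IHk] x rankx Kx.
  exists [::] => //; rewrite big_nil; apply: contrapT => /eqP x0.
  have : (size [:: x] <= 0)%N; last by [].
  apply: rankx; last by rewrite free_cons span_nil nil_free memv0 x0.
  by move=> v; rewrite inE => /eqP ->; split=> //; exact: dominated_refl.
(* A free family in the face of [z] stays free when [y] is added, because the face of [z] misses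
   [y]; so the rank bound drops by one. *)
have sub z y : K z -> dominated K x z -> K y -> dominated K x y ->
    ~ dominated K z y -> exists2 s, z = \sum_(v <- s) v &
    forall v, v \in s -> extreme_vector K v.
  move=> Kz xz Ky xy zy; apply: IHk => // s Hs frees.
  rewrite -ltnS; apply: (rankx (y :: s)).
    move=> v; rewrite in_cons => /orP [/eqP ->//|/Hs [Kv zv]]; split=> //.
    exact: (dominated_trans coneK) zv.
  by rewrite free_cons frees andbT; apply/negP => /dominated_span-/(_ z Kz Hs).
have [extx|nextx] := pselect (extreme_vector K x).
  by exists [:: x]; rewrite ?big_seq1 // => v; rewrite inE => /eqP ->.
have [->|x0] := eqVneq x 0; first by exists [::]; rewrite ?big_nil.
have [y [Ky xy Hy]] : exists y, [/\ K y, dominated K x y &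
    forall c, 0 <= c -> y <> c *: x].
  apply: contrapT => H; apply: nextx; split=> //; rewrite PhiE //.
  apply/seteqP; split=> [y [Ky xy]|_ [c c0 <-]]; last first.
    split; first exact: (coneZ coneK).
    by apply: (dominatedZr coneK) => //; exact: dominated_refl.
  apply: contrapT => Hy; apply: H; exists y; split=> // c c0 yE.
  by apply: Hy; exists c.
(* The face of [y'] misses [x], and the face of the later [x'] misses [y']. The induction applies to
   both, and [x = x' + c *: y']. *)
have [t t0 [Ky' y'x]] := subtract_maximal Ky Kx x0.
set y' := y - t *: x in Ky' y'x.
have y'0 : y' != 0 by apply/eqP => /subr0_eq; exact: Hy.
have xy' : dominated K x y'.
  apply: (dominated_trans coneK) xy _; apply: dominated_subl.
  by rewrite opprB addrC subrK; exact: (coneZ coneK).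
have [c c0 [Kx' x'y']] := subtract_maximal Kx Ky' y'0.
set x' := x - c *: y' in Kx' x'y'.
have xx' : dominated K x x'.
  by apply: dominated_subl; rewrite opprB addrC subrK; exact: (coneZ coneK).
have [s1 x'E Hs1] := sub x' y' Kx' xx' Ky' xy' x'y'.
have [s2 y'E Hs2] := sub y' x Ky' xy' Kx (dominated_refl coneK x) y'x.
have xE : x = x' + c *: y' by rewrite subrK.
have [c_eq0|cneq0] := eqVneq c 0.
  by exists s1 => //; rewrite xE c_eq0 scale0r addr0.
exists (s1 ++ [seq c *: v | v <- s2]).
  by rewrite big_cat big_map -scaler_sumr -x'E -y'E.
move=> v; rewrite mem_cat => /orP [/Hs1//|/mapP [w /Hs2 extw ->]].
by apply: extreme_vectorZ => //; rewrite lt_neqAle eq_sym cneq0.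
Qed.

End Minkowski.

(** * Exponents of primitive matrices *)

Section MinimalPolynomialDegree.
Set Implicit Arguments.
Unset Strict Implicit.
Import GRing.Theory.
Variables (F : fieldType) (n : nat).
Implicit Types A : 'M[F]_n.+1.

Lemma horner_mx_comb A (q : {poly F}) : exists c : nat -> F,
  horner_mx A q = \sum_(i < degree_mxminpoly A) c i *: A ^+ i.
Proof.
have /submxP [D DE] := horner_mx_mem A q.
exists (fun i => oapp (D 0) 0 (insub i)).
apply: (can_inj mxvecK); rewrite DE mulmx_sum_row linear_sum.
by apply: eq_bigr => i _; rewrite valK rowK linearZ.
Qed.

Lemma horner_mxXn A k : horner_mx A 'X^k = A ^+ k.
Proof. by rewrite rmorphXn /= horner_mx_X. Qed.

Lemma expmx_comb A k : exists c : nat -> F,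
  A ^+ k = \sum_(i < degree_mxminpoly A) c i *: A ^+ i.
Proof. by rewrite -horner_mxXn; exact: horner_mx_comb. Qed.

(** All powers of [A ^+ l] are polynomials in [A], so they lie in the span of the first
    [degree_mxminpoly A] powers of [A]. *)
Lemma degree_mxminpolyX A l : (degree_mxminpoly (A ^+ l) <= degree_mxminpoly A)%N.
Proof.
rewrite {1}/degree_mxminpoly; case: ex_minnP => d _; apply.
apply: leq_trans (rank_leq_row (powers_mx A (degree_mxminpoly A))).
by apply/mxrankS/row_subP => i; rewrite rowK -exprM -horner_mxXn horner_mx_mem.
Qed.

Lemma degree_mxminpoly_le A : (degree_mxminpoly A <= n.+1)%N.
Proof.
rewrite -ltnS -size_mxminpoly -(size_char_poly A).
by apply: dvdp_leq (mxminpoly_dvd_char A); rewrite monic_neq0 ?char_poly_monic.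
Qed.

End MinimalPolynomialDegree.

(** * Growth of faces under a primitive matrix *)

Section PrimitiveMatrix.
Set Implicit Arguments.
Unset Strict Implicit.
Import Order.TTheory GRing.Theory Num.Theory.
Import numFieldNormedType.Exports.
Variables (R : realType) (n : nat) (K : set 'cV[R]_n.+1) (A : 'M[R]_n.+1).
Implicit Types (x y z u v : 'cV[R]_n.+1) (t c : R) (s : seq 'cV[R]_n.+1).
Hypothesis properK : proper_cone K.
Hypothesis primA : primitive K A.

Let coneK : convex_cone K. Proof. by case: properK. Qed.
Let d := degree_mxminpoly A.

(** The dimension [n.+1] is positive, so there is a nonzero [w]; small positive multiples of [w] and
    [- w] would both lie in [K]. *)
Lemma not_interior0 : ~ K° (0 : 'cV[R]_n.+1).
Proof.
pose w : 'cV[R]_n.+1 := const_mx 1.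
move=> /near_line -/(_ w) [e e0 He].
have e2 : 0 < e / 2 by rewrite divr_gt0.
have lte : `|e / 2| < e.
  by rewrite gtr0_norm // ltr_pdivrMr // ltr_pMr // ltr1n.
have : (e / 2) *: w = 0.
  apply: (pointed properK); first by have := He _ lte; rewrite add0r.
  by rewrite -scaleNr; have := He (- (e / 2)); rewrite normrN add0r; apply.
move=> /eqP; rewrite scaler_eq0 gt_eqF //= => /eqP /matrixP /(_ 0 0).
by rewrite !mxE => /eqP; rewrite oner_eq0.
Qed.

Lemma cone_expmx k x : K x -> K (A ^+ k *m x).
Proof.
elim: k x => [|k IHk] x Kx; first by rewrite expr0 mul1mx.
by rewrite exprSr -mulmxA; apply: IHk; exact: primA.1.
Qed.

Lemma dominated_expmx k x y : K x -> dominated K x y ->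
  dominated K (A ^+ k *m x) (A ^+ k *m y).
Proof.
move=> Kx [t t0 Kt]; exists t => //.
by rewrite scalemxAr -mulmxBr; exact: cone_expmx.
Qed.

Lemma mulmx_neq0 x : K x -> x != 0 -> A *m x != 0.
Proof.
move=> Kx x0; apply/eqP => Ax0; case: primA => _ [p [p0 /(_ x Kx x0)]].
by rewrite -(prednK p0) exprSr -mulmxA Ax0 mulmx0; exact: not_interior0.
Qed.

Lemma interior_neq0 x : K° x -> x != 0.
Proof. by move=> Kx; apply: contra_notN not_interior0 => /eqP <-. Qed.

Lemma interior_cone x : K° x -> K x.
Proof. exact: interior_subset. Qed.

(** An interior [x] dominates [A ^+ p.-1 *m x], so [A *m x] dominates [A ^+ p *m x], which is
    interior for a suitable [p]. *)
Lemma interior_mulmx x : K° x -> K° (A *m x).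
Proof.
move=> Ix; have Kx := interior_cone Ix.
case: primA => _ [p [p0 /(_ x Kx (interior_neq0 Ix))]] IAx.
apply: (dominated_interior coneK IAx).
rewrite -(prednK p0) exprS -mulmxA.
by apply: (@dominated_expmx 1) => //; exact: (interior_dominated coneK).
Qed.

Lemma interior_expmxW p q x : (p <= q)%N -> K° (A ^+ p *m x) -> K° (A ^+ q *m x).
Proof.
move=> /subnK <- Ix; elim: (q - p)%N => // k IHk.
by rewrite addSn exprS -mulmxA; exact: interior_mulmx.
Qed.

Lemma dominated_cycle k l x : K x -> dominated K (A ^+ l *m x) x ->
  dominated K (A ^+ (k * l) *m x) x.
Proof.
move=> Kx lx; elim: k => [|k IHk].
  by rewrite expr0 mul1mx; exact: dominated_refl.
rewrite mulSn addnC exprD -mulmxA; apply: (dominated_trans coneK) IHk.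
exact/dominated_expmx/lx/cone_expmx.
Qed.

(* By hypothesis the faces of the vectors [A ^+ (l * k) *m x] increase with [k],
   and those with [k < d] already span all of them. *)
Lemma interior_cycle l x : K x -> x != 0 -> (0 < l)%N ->
  dominated K (A ^+ l *m x) x -> K° (A ^+ ((d - 1) * l) *m x).
Proof.
move=> Kx x0 l0 lx; case: primA => _ [p [p0 /(_ x Kx x0)]] Ip.
have {}Ip : K° ((A ^+ l) ^+ p *m x).
  by rewrite -exprM; apply: interior_expmxW Ip; rewrite leq_pmull.
apply: (dominated_interior coneK Ip).
have [c ->] := expmx_comb (A ^+ l) p; rewrite mulmx_suml.
have Kd := cone_expmx ((d - 1) * l) Kx.
apply: (big_ind (dominated K _)) => [|u w|i _]; first exact: dominated0.
- exact: (dominatedDr coneK).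
rewrite -scalemxAl -exprM [(l * i)%N]mulnC.
have Ki := cone_expmx (i * l) Kx.
have di : dominated K (A ^+ ((d - 1) * l) *m x) (A ^+ (i * l) *m x).
  have id : (i <= d - 1)%N.
    by have := leq_trans (ltn_ord i) (degree_mxminpolyX A l); rewrite -/d; lia.
  rewrite -(subnKC id) mulnDl.
  rewrite exprD -mulmxA; apply: dominated_expmx; first exact: cone_expmx.
  exact: dominated_cycle.
exact: (dominatedZ coneK).
Qed.

Lemma gammaP : power_positive K A (gamma K A) /\
  forall q, power_positive K A q -> (gamma K A <= q)%N.
Proof.
apply: (@xgetPex _ 0%N [set p | power_positive K A p /\
  forall q, power_positive K A q -> (p <= q)%N]).
have ex : exists p, `[< power_positive K A p >].
  by case: primA => _ [p Hp]; exists p; exact/asboolP.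
case: (ex_minnP ex) => p /asboolP Hp minp; exists p; split=> // q Hq.
exact/minp/asboolP.
Qed.

(** Positivity need only be tested on extreme vectors: a nonzero vector of [K] is a nonempty sum of
    them, and one interior summand makes the sum interior. *)
Lemma lt_gamma N : (0 < N < gamma K A)%N ->
  exists x, extreme_vector K x /\ ~ K° (A ^+ N *m x).
Proof.
move=> /andP [N0 Ng]; apply: contrapT => H.
suff /gammaP.2 : power_positive K A N by rewrite leqNgt Ng.
split=> // x Kx x0; have [[|v s] xE exts] := Minkowski properK Kx.
  by rewrite xE big_nil eqxx in x0.
have Kv : K° (A ^+ N *m v).
  apply: contrapT => Kv; apply: H; exists v; split=> //.
  by apply: exts; rewrite mem_head.
rewrite xE big_cons mulmxDr; apply: (interiorD coneK) => //.
apply/cone_expmx/(cone_sum coneK) => w ws.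
by have [] := exts w; rewrite // in_cons ws orbT.
Qed.

Variable x0 : 'cV[R]_n.+1.
Hypotheses (Kx0 : K x0) (x0_neq0 : x0 != 0) (x0_bd : ~ K° x0).

(** Otherwise the boundary vector [x0] would dominate all [A ^+ (p * q) *m x0], one of which is
    interior. *)
Lemma not_dominated_pow p : (0 < p)%N -> ~ dominated K x0 (A ^+ p *m x0).
Proof.
move=> p0 dx; apply: x0_bd; case: primA => _ [q [q0 /(_ x0 Kx0 x0_neq0)]].
move=> /(interior_expmxW (leq_pmull q p0)) Iq.
apply: (dominated_interior coneK Iq); rewrite mulnC.
elim: q {q0 Iq} => [|q IHq]; first by rewrite expr0 mul1mx; exact: dominated_refl.
rewrite mulSn addnC exprD -mulmxA; apply: (dominated_trans coneK) IHq _.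
exact: dominated_expmx.
Qed.

Lemma degree_gt1 : (1 < d)%N.
Proof.
rewrite ltnNge; apply/negP; rewrite mxminpoly_linear_is_scalar => /is_scalar_mxP.
move=> [c Ac]; apply: (@not_dominated_pow 1) => //; rewrite expr1 Ac mul_scalar_mx.
exact/(dominatedZ coneK)/dominated_refl.
Qed.

(* Writing [A ^+ 2 = a *: A + b *: 1], either [b <= 0], and then [A *m x] dominates
   all [A ^+ k *m x] with [k > 0], or [a, b > 0], and then [A ^+ 2 *m x]
   dominates [x + A *m x]. *)
Lemma degree2_power_positive : d = 2%N -> power_positive K A 2.
Proof.
move=> d2; have [c] := expmx_comb A 2.
rewrite -/d d2 big_ord_recl big_ord1 /= expr0 expr1.
move: (c 0%N) (c 1%N) => b a A2.
have A2x x : A ^+ 2 *m x = b *: x + a *: (A *m x).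
  by rewrite A2 mulmxDl -!scalemxAl mul1mx.
split=> // x Kx xn0; case: primA => KA [p [p0 /(_ x Kx xn0)]] Ip.
have KAx := KA x Kx; have KA2x := cone_expmx 2 Kx.
have [b0|b0] := leP b 0.
  have KAxa : K (a *: (A *m x)).
    rewrite -[_ *: _](addKr (b *: x)) -A2x addrC -scaleNr; apply: (coneD coneK) => //.
    by apply: (coneZ coneK); rewrite ?oppr_ge0.
  have a0 : 0 < a.
    rewrite ltNge; apply/negP => a0; have KNb : K ((- b) *: x).
      by apply: (coneZ coneK); rewrite ?oppr_ge0.
    have Ka : K ((- a) *: (A *m x)) by apply: (coneZ coneK); rewrite ?oppr_ge0.
    have : A ^+ 2 *m x = 0.
      apply: (coneD_eq0 properK KA2x (coneD coneK KNb Ka)).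
      by rewrite A2x !scaleNr addrACA !subrr addr0.
    rewrite expr2 -mulmxA => /eqP; apply/negP.
    by rewrite mulmx_neq0 // mulmx_neq0.
  have AA2 y : K y -> dominated K (A *m y) (A ^+ 2 *m y).
    move=> Ky; exists a => //; rewrite A2x opprD addrCA subrr addr0 -scaleNr.
    by apply: (coneZ coneK); rewrite ?oppr_ge0.
  have AAk k : dominated K (A *m x) (A ^+ k.+1 *m x).
    elim: k => [|k IHk]; first by rewrite expr1; exact: dominated_refl.
    apply: (dominated_trans coneK) IHk _.
    have -> : A ^+ k.+1 *m x = A *m (A ^+ k *m x) by rewrite mulmxA -[_ *m A ^+ k]exprS.
    have -> : A ^+ k.+2 *m x = A ^+ 2 *m (A ^+ k *m x).
      by rewrite mulmxA -[_ *m A ^+ k]exprD.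
    by apply: AA2; exact: cone_expmx.
  rewrite expr2 -mulmxA; apply: interior_mulmx.
  apply: (dominated_interior coneK Ip); rewrite -(prednK p0); exact: AAk.
(* With [a <= 0] the boundary vector [x0] would dominate [A ^+ 2 *m x0], with factor [b]. *)
have a0 : 0 < a.
  rewrite ltNge; apply/negP => a0; apply: (@not_dominated_pow 2) => //.
  exists b => //; rewrite A2x opprD addrA subrr add0r -scaleNr.
  by apply: (coneZ coneK); rewrite ?oppr_ge0 //; exact: primA.1.
have D0 : dominated K (A ^+ 2 *m x) x.
  exists b^-1; rewrite ?invr_gt0 // A2x scalerDr scalerK ?gt_eqF //.
  rewrite addrC addKr scalerA; apply: (coneZ coneK) => //.
  by rewrite mulr_ge0 ?invr_ge0 ?ltW.
have D1 : dominated K (A ^+ 2 *m x) (A *m x).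
  exists a^-1; rewrite ?invr_gt0 // A2x scalerDr (scalerK (lt0r_neq0 a0)).
  rewrite addrK scalerA; apply: (coneZ coneK) => //.
  by rewrite mulr_ge0 ?invr_ge0 ?ltW.
apply: (dominated_interior coneK Ip); have [e ->] := expmx_comb A p.
rewrite -/d d2 big_ord_recl big_ord1 /= expr0 expr1 mulmxDl -!scalemxAl mul1mx.
by apply: (dominatedDr coneK); exact: (dominatedZ coneK).
Qed.

End PrimitiveMatrix.

(** * Digraphs with few short closed walks *)

Lemma mem_path_arcs m i j :
  ((i, j) \in path_arcs m) = [&& 0 < i, i < m & j == i.+1]%N.
Proof.
apply/mapP/idP => [[k]|/and3P [i0 im /eqP ->]]; last first.
  by exists i => //; rewrite mem_iota; lia.
by rewrite mem_iota => km [-> ->]; lia.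
Qed.

Section Walks.
Set Implicit Arguments.
Unset Strict Implicit.
Local Open Scope nat_scope.
Variables (T : finType) (e : rel T).
Implicit Types (a b c u w y z : T) (p x : nat -> T).

Fixpoint walk l a b : Prop :=
  if l is l'.+1 then exists2 c, e a c & walk l' c b else a = b.

Lemma walk_cat k l a b c : walk k a b -> walk l b c -> walk (k + l) a c.
Proof.
elim: k a => [|k IHk] a /=; first by move=> ->.
by move=> [u au ub] bc; exists u => //; exact: IHk bc.
Qed.

Lemma walk1 a b : e a b -> walk 1 a b.
Proof. by exists b. Qed.

Lemma walk_fun p i j : i <= j -> (forall k, i <= k < j -> e (p k) (p k.+1)) ->
  walk (j - i) (p i) (p j).
Proof.
move=> /subnK; move: (j - i) => l <-.
elim: l i => [|l IHl] i arcs //; exists (p i.+1); first by apply: arcs; lia.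
by rewrite addSnnS; apply: IHl => k ik; apply: arcs; lia.
Qed.

Lemma walkE l a b : walk l a b ->
  exists p, [/\ p 0 = a, p l = b & forall i, i < l -> e (p i) (p i.+1)].
Proof.
elim: l a => [|l IHl] a /=; first by move=> ->; exists (fun=> b).
move=> [c ac /IHl [p [p0 pl parc]]]; exists (fun i => if i is j.+1 then p j else a).
by split=> // -[|i] //; [rewrite p0 | exact: parc].
Qed.

Lemma forward_walk m x : (forall i, 0 < i < m -> e (x i) (x i.+1)) ->
  forall i j, 0 < i -> i <= j <= m -> walk (j - i) (x i) (x j).
Proof.
move=> xpath i j i0 /andP [ij jm].
by apply: walk_fun => // k kij; apply: xpath; lia.
Qed.

Lemma back_walk m x : (forall i, 0 < i < m -> e (x i) (x i.+1)) ->
  forall i j, 0 < j -> j <= i <= m -> e (x i) (x j) -> walk (i - j + 1) (x j) (x j).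
Proof.
move=> xpath i j j0 ij eij.
by apply: walk_cat (walk1 eij); exact: (forward_walk xpath).
Qed.

Lemma exists_closed_walk y : (forall a, exists b, e a b) ->
  exists k l z, [/\ 0 < l, walk k y z & walk l z z].
Proof.
move=> /choice [g eg]; pose p i := iter i g y.
have parc i : e (p i) (p i.+1) by exact: eg.
apply: contrapT => H; have : #|'I_#|T|.+1| <= #|T|; last by rewrite card_ord ltnn.
apply: (@leq_card _ _ (fun i : 'I__ => p i)).
have inj i j : p i = p j -> ~ (i < j).
  move=> pij ij; apply: H; exists i, (j - i), (p i); split; first lia.
    by rewrite -{1}[i]subn0 -[y]/(p 0); apply: walk_fun.
  by rewrite {2}pij; apply: walk_fun => //; exact: ltnW.
move=> i j /= pij; apply: val_inj => /=.
by have := inj _ _ pij; have := inj _ _ (esym pij); lia.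
Qed.

(** First the length [l] of a closed walk reachable from [y] is minimised, then the distance [t]
    from [y] to a closed walk of that length. *)
Lemma shortest_lasso y : (forall a, exists b, e a b) -> exists p t l,
  [/\ p 0 = y, 0 < l /\ p (t + l) = p t,
      forall i, i < t + l -> e (p i) (p i.+1),
      forall i j, i < t + l -> j < t + l -> p i = p j -> i = j
    & forall k z j, walk k y z -> 0 < j -> walk j z z -> l <= j].
Proof.
move=> out; pose closed_at l := exists k z, [/\ 0 < l, walk k y z & walk l z z].
have exl : exists l, `[< closed_at l >].
  have [k [l [z H]]] := exists_closed_walk y out.
  by exists l; apply/asboolP; exists k, z.
case: (ex_minnP exl) => l /asboolP [k0 [z0 [l0 yz0 z0z0]]] minl.
have {}minl k z j : walk k y z -> 0 < j -> walk j z z -> l <= j.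
  by move=> yz j0 zz; apply/minl/asboolP; exists k, z.
pose near_at t := exists z, walk t y z /\ walk l z z.
have ext : exists t, `[< near_at t >] by exists k0; apply/asboolP; exists z0.
case: (ex_minnP ext) => t /asboolP [z [yz zz]] mint.
have {}mint k u : walk k y u -> walk l u u -> t <= k.
  by move=> yu uu; apply/mint/asboolP; exists u.
have [q [q0 qt qarc]] := walkE yz; have [r [r0 rl rarc]] := walkE zz.
pose p i := if i <= t then q i else r (i - t).
have pt : p t = z by rewrite /p leqnn.
have pE i : p (t + i) = r i.
  rewrite /p; case: leqP => [it|_]; last by congr r; lia.
  by have -> : i = 0 by [lia]; rewrite addn0 qt r0.
have parc i : i < t + l -> e (p i) (p i.+1).
  have [it|it] := ltnP i t.
    by move=> _; rewrite /p it (ltnW it); exact: qarc.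
  move=> il; have -> : i = t + (i - t) by lia.
  by rewrite -addnS !pE; apply: rarc; lia.
have ptl : p (t + l) = p t by rewrite pE rl pt.
have sub i j : i <= j -> j <= t + l -> walk (j - i) (p i) (p j).
  by move=> ij jl; apply: walk_fun => // k kij; apply: parc; lia.
have p0 : p 0 = y by rewrite /p.
have reach i : i <= t + l -> walk i y (p i).
  by move=> il; rewrite -p0 -{1}(subn0 i); exact: sub.
have inj i j : i < j -> j < t + l -> p i <> p j.
  move=> ij jl pij.
  (* A repetition on the circuit shortens the circuit, and one on the approach shortens the
     approach. One between the two puts [p i], at distance [i < t], on a closed walk of length
     [l]. *)
  have [ti|it] := leqP t i.
    have : l <= j - i.
      apply: (minl i (p i)); [apply: reach; lia | lia |].
      by rewrite {2}pij; apply: sub; lia.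
    lia.
  have [jt|tj] := leqP j t.
    suff : t <= i + (t - j) by lia.
    apply: (mint _ z) => //; apply: (@walk_cat _ _ _ (p i)).
      by apply: reach; lia.
    by rewrite pij -pt; apply: sub; lia.
  suff : t <= i by lia.
  apply: (mint _ (p i)); first by apply: reach; lia.
  rewrite pij; have -> : l = (t + l - j) + (j - t) by lia.
  apply: (@walk_cat _ _ _ z).
    by rewrite -pt -ptl; apply: sub; lia.
  by rewrite -pt; apply: sub; lia.
exists p, t, l; split=> // i j il jl pij.
case: (ltngtP i j) => // ij; first by case: (inj i j).
by case: (inj j i).
Qed.

(* The vertices are x 1, ..., x m; the other values of x are irrelevant. *)
Definition given_by m (D : seq (nat * nat)) : Prop := exists x : nat -> T,
  [/\ forall i j, 0 < i <= m -> 0 < j <= m -> x i = x j -> i = j,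
      forall u, exists2 i, 0 < i <= m & x i = u
    & forall i j, 0 < i <= m -> 0 < j <= m ->
        e (x i) (x j) = ((i, j) \in D)].

Lemma label_surj m x u : #|T| = m ->
  (forall i j, 0 < i <= m -> 0 < j <= m -> x i = x j -> i = j) ->
  exists2 i, 0 < i <= m & x i = u.
Proof.
move=> Tm xinj; pose f (i : 'I_m) := x i.+1.
have finj : injective f.
  by move=> i j /xinj H; apply: val_inj; apply: succn_inj; apply: H => /=.
have [|g _ gK] := inj_card_bij finj; first by rewrite card_ord Tm.
by exists (g u).+1; [rewrite /= | exact: gK].
Qed.

Lemma given_byI m x (D : seq (nat * nat)) : #|T| = m ->
  (forall i j, 0 < i <= m -> 0 < j <= m -> x i = x j -> i = j) ->
  (forall i j, 0 < i <= m -> 0 < j <= m -> e (x i) (x j) -> (i, j) \in D) ->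
  (forall i j, (i, j) \in D -> e (x i) (x j)) -> given_by m D.
Proof.
move=> Tm xinj sub sup; exists x; split=> // [u|i j im jm].
  exact: label_surj.
by apply/idP/idP; [exact: sub | exact: sup].
Qed.

Lemma level_walk (h : nat -> T -> Prop) i l a b :
  (forall j u w, h j u -> e u w -> h j.+1 w) -> h i a -> walk l a b -> h (i + l) b.
Proof.
move=> step; elim: l i a => [|l IHl] i a ha /=; first by move=> <-; rewrite addn0.
by move=> [c /(step _ _ _ ha) hc /(IHl _ _ hc)]; rewrite addnS.
Qed.

Lemma modnS_if L i : 0 < L ->
  i.+1 %% L = if (i %% L).+1 == L then 0 else (i %% L).+1.
Proof.
move=> L0; rewrite -addn1 -modnDml addn1; case: eqP => [->|ne]; first exact: modnn.
by rewrite modn_small //; have := ltn_pmod i L0; lia.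
Qed.

End Walks.

Ltac decide_arcs :=
  rewrite /delete_arcs ?mem_filter ?mem_cat ?mem_path_arcs ?inE ?xpair_eqE /=.

(** * Enumeration of the digraphs around a long shortest circuit *)

Section Classification.
Set Implicit Arguments.
Unset Strict Implicit.
Local Open Scope nat_scope.
Variables (T : finType) (e : rel T) (m : nat).
Implicit Types (a b c u w y z : T) (p x : nat -> T).
Hypotheses (m_ge4 : 4 <= m) (cardT : #|T| = m).
Hypothesis aperiodic : forall z l, 0 < l ->
  ~ forall w, walk e l z w -> w = z.

(* The circuit is x 3, ..., x m, at distance 2 from x 1. *)
Lemma classify_short x :
  (forall i j, 0 < i <= m -> 0 < j <= m -> x i = x j -> i = j) ->
  (forall i, 0 < i < m -> e (x i) (x i.+1)) -> e (x m) (x 3) ->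
  (forall i l, 0 < i <= m -> 0 < l -> walk e l (x i) (x i) -> m - 2 <= l) ->
  (forall k i l, k <= 1 -> 0 < i <= m -> 0 < l -> walk e k (x 1) (x i) ->
     walk e l (x i) (x i) -> m - 1 <= l) ->
  exists D, listed_digraph m D /\ given_by e m D.
Proof.
move=> xinj xpath xm3 short short1.
have fw := forward_walk xpath; have bk := back_walk xpath.
(* The closed walk starts at [x j], at distance [j - 1 <= 1] from [x 1], so the stronger bound
   [m - 1] applies. *)
have bk12 i j : 0 < j <= 2 -> j <= i <= m -> e (x i) (x j) -> m - 2 <= i - j.
  move=> j12 ij eij; suff : m - 1 <= i - j + 1 by lia.
  apply: (short1 (j - 1) j); [lia | lia | lia | by apply: fw; lia |].
  by apply: bk => //; lia.
(* A backward arc closes a walk with the path, a forward jump closes one with [x m -> x 3]. The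
   length bounds leave these four types; jumps from [x 2] survive because [x 2] is off the
   circuit. *)
have arc i j : 0 < i <= m -> 0 < j <= m -> e (x i) (x j) ->
    [\/ j = i.+1, i = m /\ j = 3, (i = m \/ i = m - 1 /\ j = 1) /\ j <= 2
      | i = 2 /\ 4 <= j].
  move=> im jm eij; have [ji|ij] := leqP j i.
    have [j2|j3] := leqP j 2; last first.
      suff : m - 2 <= i - j + 1 by constructor 2; lia.
      by apply: (short j) => //; [lia | apply: bk; lia].
    suff : m - 2 <= i - j by constructor 3; lia.
    by apply: bk12 => //; lia.
  have [->|ji1] := eqVneq j i.+1; first by constructor 1.
  have [i1|i2] := leqP i 1.
    have i_1 : i = 1 by lia.
    suff : m - 1 <= m - j + (1 + (j - 3)) by lia.
    apply: (short1 1 j) => //; first lia.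
      by apply: walk1; rewrite -i_1.
    by apply: walk_cat (fw _ _ _ _) (walk_cat (walk1 xm3) (fw _ _ _ _)); lia.
  have [i_2|i_2] := eqVneq i 2; first by constructor 4; lia.
  suff : m - 2 <= m - j + (1 + (i - 3 + 1)) by lia.
  apply: (short j) => //; first lia.
  by apply: walk_cat (fw _ _ _ _)
    (walk_cat (walk1 xm3) (walk_cat (fw _ _ _ _) (walk1 eij))); lia.
(* A jump from [x 2] and an arc back to [x 1] or [x 2] together close a walk that skips vertices.
   The bound [m - 1] restricts [j] in this and the next two claims. *)
have a2m1 j : 4 <= j <= m -> e (x 2) (x j) -> e (x m) (x 1) -> j = 4.
  move=> jm e2j em1; suff : m - 1 <= 1 + (1 + (m - j + 1)) by lia.
  apply: (short1 0 1) => //; try lia.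
  apply: walk_cat (walk1 (xpath 1 _)) _; first lia.
  by apply: walk_cat (walk1 e2j) (walk_cat (fw _ _ _ _) (walk1 em1)); lia.
have a2m2 j : 4 <= j <= m -> e (x 2) (x j) -> e (x m) (x 2) -> False.
  move=> jm e2j em2; suff : m - 1 <= 1 + (m - j + 1) by lia.
  apply: (short1 1 2) => //; try lia.
    by apply: walk1; apply: xpath; lia.
  by apply: walk_cat (walk1 e2j) (walk_cat (fw _ _ _ _) (walk1 em2)); lia.
have a2n1 j : 4 <= j <= m -> e (x 2) (x j) -> e (x (m - 1)) (x 1) -> j = m.
  move=> jm e2j em1; apply: contrapT => jneqm.
  suff : m - 1 <= 1 + (1 + (m - 1 - j + 1)) by lia.
  apply: (short1 0 1) => //; try lia.
  apply: walk_cat (walk1 (xpath 1 _)) _; first lia.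
  by apply: walk_cat (walk1 e2j) (walk_cat (fw _ _ _ _) (walk1 em1)); lia.
(* Otherwise no arc leaves the circuit [x 3, ..., x m], and all walks of length [m - 2] from [x 3]
   return to [x 3], against aperiodicity. *)
have escape : [|| e (x m) (x 1), e (x m) (x 2) | e (x (m - 1)) (x 1)].
  apply/negPn/negP; rewrite !negb_or => /and3P [/negP nm1 /negP nm2 /negP nn1].
  pose c k := x (3 + k %% (m - 2)).
  have L0 : 0 < m - 2 by lia.
  apply: (@aperiodic (c 0) _ L0) => w wz.
  have -> : c 0 = c (0 + (m - 2)) by rewrite /c add0n modnn mod0n.
  apply: (@level_walk _ _ (fun k u => u = c k) _ _ _ _ _ _ wz) => // k u {wz}w -> eku.
  have kL := ltn_pmod k L0.
  rewrite /c modnS_if //; rewrite /c in eku; set r := k %% (m - 2) in kL eku *.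
  have [i im wE] := label_surj w cardT xinj; rewrite -{}wE in eku *; congr x.
  have rm : 0 < 3 + r <= m by lia.
  have [iE|rE|[[rE|[rE i1]] i2]|] := arc _ _ rm im eku.
  - by case: eqP; lia.
  - by case: eqP; lia.
  - have [i1|i1] : i = 1 \/ i = 2 by lia.
      by move: eku; rewrite rE i1.
    by move: eku; rewrite rE i1.
  - by move: eku; rewrite rE i1.
  - by lia.
have xB i j : (i, j) \in B m -> e (x i) (x j).
  decide_arcs => /orP [/and3P [i0 im /eqP ->]|/andP [/eqP -> /eqP ->] //].
  by apply: xpath; lia.
have given D : (forall i j, (i, j) \in D -> (i, j) \in B m \/ e (x i) (x j)) ->
    (forall i j, (i, j) \in B m -> (i, j) \in D) ->
    [/\ e (x m) (x 1) -> (m, 1) \in D, e (x m) (x 2) -> (m, 2) \in D,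
        e (x (m - 1)) (x 1) -> (m - 1, 1) \in D
      & forall j, 4 <= j <= m -> e (x 2) (x j) -> (2, j) \in D] -> given_by e m D.
  move=> supD BD [D1 D2 D3 D4]; apply: (given_byI cardT xinj) => i j; last first.
    by move=> /supD [/xB|].
  move=> im jm eij; have [ji|ji|[H j2]|[i2 j4]] := arc i j im jm eij.
  - by apply: BD; decide_arcs; lia.
  - by apply: BD; decide_arcs; lia.
  - case: H => [iE|[iE jE]]; last by rewrite iE jE in eij *; exact: D3.
    have [jE|jE] : j = 1 \/ j = 2 by lia.
      by rewrite iE jE in eij *; exact: D1.
    by rewrite iE jE in eij *; exact: D2.
  - by rewrite i2 in eij *; apply: D4 => //; lia.
have [[j /andP [jm e2j]]|no2] := pselect (exists j, (4 <= j <= m) && e (x 2) (x j)).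
  have em2 : e (x m) (x 2) = false by apply/negP => /(a2m2 _ jm e2j).
  case em1 : (e (x m) (x 1)) escape => /=.
    move=> _; have j4 := a2m1 j jm e2j em1; rewrite {j}j4 in jm e2j.
    have e2 j : 4 <= j <= m -> e (x 2) (x j) -> j = 4 by move=> *; exact: a2m1.
    have [en1|nn1] := boolP (e (x (m - 1)) (x 1)).
      (* The arcs from [x m] and [x (m - 1)] to [x 1] force [j = 4] and [j = m]. *)
      have m4 := a2n1 4 jm e2j en1.
      exists (F3 m ++ [:: (3, 1)]); split; first by right; right; split; [lia|left].
      apply: given.
      - move=> i j; decide_arcs => /orP [/orP [->|/orP [|]]|]; first (by left);
        by move=> /andP [/eqP -> /eqP ->]; right; rewrite // -m4 in en1.
      - by move=> i j; decide_arcs => ->.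
      - rewrite em2; split=> // [_|_|j /e2 H /H ->]; decide_arcs; lia.
    exists (F3 m); split; first by left; rewrite !inE eqxx !orbT.
    apply: given.
    - move=> i j; decide_arcs => /orP [->|/orP [|]]; first (by left);
      by move=> /andP [/eqP -> /eqP ->]; right.
    - by move=> i j; decide_arcs => ->.
    - by rewrite em2 (negbTE nn1); split=> // [_|j /e2 H /H ->]; decide_arcs; lia.
  rewrite em2 /= => en1; have jE := a2n1 j jm e2j en1; rewrite {j}jE in jm e2j.
  (* For [m = 4] this is also [F3] with [(3, 1)] substituted for [(4, 1)]. *)
  exists (F4 m); split; first by left; rewrite !inE eqxx !orbT.
  apply: given.
  - move=> i j; decide_arcs => /orP [->|/orP [|]]; first (by left);
    by move=> /andP [/eqP -> /eqP ->]; right.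
  - by move=> i j; decide_arcs => ->.
  - rewrite em2 em1; split=> // [_|j jm']; first by decide_arcs; lia.
    by move=> /(a2n1 j jm') /(_ en1) ->; decide_arcs; lia.
have {}no2 j : 4 <= j <= m -> e (x 2) (x j) -> False.
  by move=> jm e2j; apply: no2; exists j; rewrite jm.
(* The absent ones among the three optional arcs; [escape] says that one of them is present, whence
   [size s <= 2]. *)
pose s := [seq q <- [:: (m - 1, 1); (m, 1); (m, 2)] | ~~ e (x q.1) (x q.2)].
have sE q : q \in s = ~~ e (x q.1) (x q.2) && (q \in [:: (m - 1, 1); (m, 1); (m, 2)]).
  by rewrite mem_filter.
exists (delete_arcs s (F5 m)); split.
  have [s0|sn] := eqVneq s [::].
    by left; rewrite s0 /delete_arcs filter_predT !inE eqxx !orbT.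
  right; left; exists s; split=> //; first exact: filter_subseq.
  rewrite lt0n size_eq0 sn /= /s /=; move: escape.
  by case: (e (x m) (x 1)); case: (e (x m) (x 2)); case: (e (x (m - 1)) (x 1)).
apply: given.
- move=> i j; rewrite /delete_arcs mem_filter sE /F5 mem_cat negb_and negbK.
  by case/andP => /orP [eij _|/negbTE ->]; [right | rewrite orbF; left].
- move=> i j ijB; rewrite /delete_arcs mem_filter sE (xB _ _ ijB) /= /F5 mem_cat ijB.
  by [].
- by split=> [H|H|H|j jm /(no2 j jm) //];
    rewrite /delete_arcs mem_filter sE H /F5 mem_cat !inE !eqxx ?orbT.
Qed.

(* The circuit is x 2, ..., x m. *)
Lemma classify_long x :
  (forall i j, 0 < i <= m -> 0 < j <= m -> x i = x j -> i = j) ->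
  (forall i, 0 < i < m -> e (x i) (x i.+1)) -> e (x m) (x 2) ->
  (forall i l, 0 < i <= m -> 0 < l -> walk e l (x i) (x i) -> m - 1 <= l) ->
  given_by e m (F1 m) \/ given_by e m (F2 m).
Proof.
move=> xinj xpath xm2 short.
have fw := forward_walk xpath; have bk := back_walk xpath.
have arc i j : 0 < i <= m -> 0 < j <= m -> e (x i) (x j) ->
    [\/ j = i.+1, i = m /\ j = 2, (i = m \/ i = m - 1) /\ j = 1 | i = 1 /\ 3 <= j].
  move=> im jm eij; have [ji|ij] := leqP j i.
    suff : m - 1 <= i - j + 1.
      have [j2|j1] := leqP 2 j; first by constructor 2; lia.
      by constructor 3; lia.
    by apply: (short j) => //; [lia | apply: bk; lia].
  have [->|ji1] := eqVneq j i.+1; first by constructor 1.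
  have [i1|i2] := leqP i 1; first by constructor 4; lia.
  suff : m - 1 <= m - j + (1 + (i - 2 + 1)) by lia.
  apply: (short j) => //; first lia.
  by apply: walk_cat (fw _ _ _ _)
    (walk_cat (walk1 xm2) (walk_cat (fw _ _ _ _) (walk1 eij))); lia.
have a1m1 j : 3 <= j <= m -> e (x 1) (x j) -> e (x m) (x 1) -> j = 3.
  move=> jm e1j em1; suff : m - 1 <= 1 + (m - j + 1) by lia.
  apply: (short 1) => //; try lia.
  by apply: walk_cat (walk1 e1j) (walk_cat (fw _ _ _ _) (walk1 em1)); lia.
have a1n1 j : 3 <= j <= m -> e (x 1) (x j) -> e (x (m - 1)) (x 1) -> j = m.
  move=> jm e1j em1; apply: contrapT => jneqm.
  suff : m - 1 <= 1 + (m - 1 - j + 1) by lia.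
  apply: (short 1) => //; try lia.
  by apply: walk_cat (walk1 e1j) (walk_cat (fw _ _ _ _) (walk1 em1)); lia.
(* Otherwise x 1 is inaccessible or a twin of x m, and all walks of length m - 1
   from x 2 return to x 2. *)
have escape : ~ e (x m) (x 1) ->
    exists j, [/\ 3 <= j <= m, e (x 1) (x j) & e (x (m - 1)) (x 1)].
  move=> nm1; apply: contrapT => no; have L0 : 0 < m - 1 by lia.
  (* After [k] steps a walk from [x 2] is at its place on the circuit, or at [x 1] in the place of
     [x m]. *)
  pose h k u := u = x (2 + k %% (m - 1)) \/ 
    [/\ k %% (m - 1) = m - 2, u = x 1 & e (x (m - 1)) (x 1)].
  apply: (@aperiodic (x 2) _ L0) => w wz.
  suff : h (0 + (m - 1)) w.
    by rewrite /h add0n modnn => -[-> //|[]]; lia.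
  apply: level_walk wz; last by left; rewrite mod0n.
  move=> k u {}w; rewrite /h modnS_if //; have := ltn_pmod k L0.
  set r := k %% (m - 1); have [i im <-] := label_surj w cardT xinj.
  move=> kL [->|[rE -> en1]] eui; last first.
    have m1 : 0 < 1 <= m by lia.
    have [iE|iE|iE|[_ i3]] := arc 1 i m1 im eui; try lia.
      by left; congr x; case: eqP; lia.
    by case: no; exists i; split=> //; lia.
  have rm : 0 < 2 + r <= m by lia.
  have [iE|rE|[rE i1]|] := arc _ i rm im eui; last by lia.
  - by left; congr x; case: eqP; lia.
  - by left; congr x; case: eqP; lia.
  - case: rE => rE; first by move: eui; rewrite rE i1.
    move: eui; rewrite rE i1 => en1.
    by right; split=> //; case: eqP; lia.
(* The other arc patterns are copies of [F2] under a renumbering r. *)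
have relabel r : (forall i, 0 < i <= m -> 0 < r i <= m) ->
    (forall i j, 0 < i <= m -> 0 < j <= m -> r i = r j -> i = j) ->
    (forall i j, 0 < i <= m -> 0 < j <= m ->
       e (x (r i)) (x (r j)) -> (i, j) \in F2 m) ->
    (forall i j, (i, j) \in F2 m ->
       [\/ 0 < r i < m /\ r j = (r i).+1, r i = m /\ r j = 2
         | e (x (r i)) (x (r j))]) ->
    given_by e m (F2 m).
  move=> rm rinj sub sup; apply: (given_byI (x := x \o r) cardT) => [i j im jm|//|i j].
    by move=> /(xinj _ _ (rm _ im) (rm _ jm)); exact: rinj.
  by case/sup=> [[ri rj]|[ri rj]|//] /=; rewrite rj ?ri //; exact: xpath.
have [em1|/negP nm1] := boolP (e (x m) (x 1)); last first.
  have [j [jm e1j en1]] := escape nm1.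
  have jE := a1n1 j jm e1j en1; rewrite {j}jE in jm e1j.
  (* The new path is [x 1, x m, x 2, ..., x (m - 1)]; the arc [x 1 -> x 2] becomes the arc [(1, 3)]
     of [F2]. *)
  right; pose r i := if i == 2 then m else if i <= 1 then i else i - 1.
  have rE i : i = 2 /\ r i = m \/ (i <= 1 /\ r i = i \/ 3 <= i /\ r i = i - 1).
    rewrite /r; case: eqP => [|i2]; first by left.
    by case: (leqP i 1) => i1; right; [left | right; lia].
  clearbody r; apply: (relabel r) => [i im|i j im jm'|i j im jm' eij|i j].
  - by have := rE i; lia.
  - by have := rE i; have := rE j; lia.
  - have ri : 0 < r i <= m by have := rE i; lia.
    have rj : 0 < r j <= m by have := rE j; lia.
    decide_arcs; have := rE i; have := rE j.
    have [rij|rij|[rij rj1]|[ri1 rj3]] := arc _ _ ri rj eij; [lia | lia | |].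
      by case: rij => rij; [rewrite rij rj1 in eij | lia].
    by have := a1n1 (r j) _ _ en1; rewrite -ri1 => /(_ _ eij); lia.
  - move=> ij; suff : 0 < r i < m /\ r j = (r i).+1 \/ (r i = m /\ r j = 2 \/
        (r i = m - 1 /\ r j = 1 \/ r i = 1 /\ r j = m)).
      by case=> [|[|[[-> ->]|[-> ->]]]]; by [constructor 1|constructor 2|constructor 3].
    by move: ij; decide_arcs; have := rE i; have := rE j; lia.
have [en1|nn1] := boolP (e (x (m - 1)) (x 1)).
  (* The new path is [x m, x 1, ..., x (m - 1)]; the arc [x m -> x 2] becomes the arc [(1, 3)] of
     [F2]. *)
  right; pose r i := if i == 1 then m else i - 1.
  have rE i : i = 1 /\ r i = m \/ i <> 1 /\ r i = i - 1.
    by rewrite /r; case: eqP => i1; [left | right].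
  clearbody r; apply: (relabel r) => [i im|i j im jm|i j im jm eij|i j].
  - by have := rE i; lia.
  - by have := rE i; have := rE j; lia.
  - have ri : 0 < r i <= m by have := rE i; lia.
    have rj : 0 < r j <= m by have := rE j; lia.
    have no : ~ (r i = 1 /\ 3 <= r j).
      move=> [ri1 rj3]; rewrite ri1 in eij; have rj' : 3 <= r j <= m by lia.
      by have := a1m1 _ rj' eij em1; have := a1n1 _ rj' eij en1; lia.
    by decide_arcs; have := rE i; have := rE j; case: (arc _ _ ri rj eij); lia.
  - move=> ij; suff : 0 < r i < m /\ r j = (r i).+1 \/ (r i = m /\ r j = 2 \/
        (r i = m - 1 /\ r j = 1 \/ r i = m /\ r j = 1)).
      by case=> [|[|[[-> ->]|[-> ->]]]]; by [constructor 1|constructor 2|constructor 3].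
    by move: ij; decide_arcs; have := rE i; have := rE j; lia.
have [e13|n13] := boolP (e (x 1) (x 3)).
  right; apply: (given_byI cardT xinj) => i j.
    move=> im jm eij; decide_arcs.
    have [|||[i1 j3]] := arc i j im jm eij; [lia | lia | |].
      by case=> [[iE|iE]] jE; [lia | rewrite iE jE (negbTE nn1) in eij].
    suff : j = 3 by lia.
    by apply: a1m1 em1; [lia | rewrite -i1].
  decide_arcs => /orP [/orP [/and3P [i0 im /eqP ->]|]|/andP [/eqP -> /eqP -> //]].
    by apply: xpath; rewrite i0.
  by case/orP => /andP [/eqP -> /eqP ->].
left; apply: (given_byI cardT xinj) => i j.
  move=> im jm eij; decide_arcs.
  have [|||[i1 j3]] := arc i j im jm eij; [lia | lia | |].
    by case=> [[iE|iE]] jE; [lia | rewrite iE jE (negbTE nn1) in eij].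
  have j_3 : j = 3 by apply: a1m1 em1; [lia | rewrite -i1].
  by rewrite i1 j_3 (negbTE n13) in eij.
decide_arcs => /orP [/and3P [i0 im /eqP ->]|].
  by apply: xpath; rewrite i0.
by case/orP => /andP [/eqP -> /eqP ->].
Qed.

End Classification.

(** * From a slow vertex to the listed digraphs *)

Section DigraphTheorem.
Set Implicit Arguments.
Unset Strict Implicit.
Local Open Scope nat_scope.
Variables (T : finType) (e : rel T) (m : nat).
Implicit Types (a b u w y z : T).
Hypotheses (m_ge4 : 4 <= m) (cardT : #|T| = m).
Hypothesis aperiodic : forall z l, 0 < l ->
  ~ forall w, walk e l z w -> w = z.
Hypothesis out : forall a, exists b, e a b.

(** By minimality of [l] the circuit has no chords, so aperiodicity provides an arc from it to an
    outside vertex [z], whence [l = m - 1]. The numbering starts with [z] and continues along the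
    circuit from an out-neighbour of [z]. *)
Lemma long_lasso y p t l : 
  p 0 = y -> m - 1 <= l -> p (t + l) = p t -> t + l <= m ->
  (forall i, i < t + l -> e (p i) (p i.+1)) ->
  (forall i j, i < t + l -> j < t + l -> p i = p j -> i = j) ->
  (forall k z j, walk e k y z -> 0 < j -> walk e j z z -> l <= j) ->
  given_by e m (F1 m) \/ given_by e m (F2 m).
Proof.
move=> p0 lm ptl tlm parc pinj minl; pose c i := p (t + i %% l).
have l0 : 0 < l by lia.
have lt_l i : i %% l < l by exact: ltn_pmod.
have carc i : e (c i) (c i.+1).
  have li := lt_l i; have : e (c i) (p (t + (i %% l).+1)).
    by rewrite addnS; apply: parc; lia.
  rewrite [c i.+1]/c modnS_if //; case: eqP => // ->.
  by rewrite addn0 ptl.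
have cmod i j : i = j %[mod l] -> c i = c j by rewrite /c => ->.
have cinj i j : c i = c j -> i = j %[mod l].
  by move=> cij; have := lt_l i; have := lt_l j; have := pinj _ _ _ _ cij; lia.
have cwalk i j : i <= j -> walk e (j - i) (c i) (c j).
  by move=> ij; apply: walk_fun.
have reach i : walk e (t + i %% l) y (c i).
  rewrite -p0 -(subn0 (t + _)); apply: walk_fun => // k kt; apply: parc.
  by have := lt_l i; lia.
have chord i j : e (c i) (c j) -> c j = c i.+1.
  move=> eij; have [li lj] := (lt_l i, lt_l j).
  rewrite -[c j](cmod _ _ (modn_mod j l)) -[c i](cmod _ _ (modn_mod i l)) in eij *.
  rewrite /c modnS_if // modn_mod; congr (p (t + _)).
  set a := j %% l in lj eij *; set b := i %% l in li eij *.
  have rj : walk e (t + a %% l) y (c a) by exact: reach.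
  have [ab|ba] := leqP a b.
    have : l <= b - a + 1.
      apply: (minl _ _ _ rj); first lia.
      exact: walk_cat (cwalk _ _ ab) (walk1 eij).
    by case: eqP; lia.
  have : l <= b + l - a + 1.
    apply: (minl _ _ _ rj); first lia.
    apply: (walk_cat (cwalk a (b + l) _)); first lia.
    by apply: walk1; rewrite (cmod (b + l) b) // modnDr.
  by case: eqP; lia.
have [i [z [eiz zC]]] : exists i z, e (c i) z /\ forall j, z <> c j.
  apply: contrapT => no; apply: (@aperiodic (c 0) _ l0) => w wz.
  have -> : c 0 = c (0 + l) by apply: cmod; rewrite add0n modnn mod0n.
  apply: (@level_walk _ _ (fun k u => u = c k) _ _ _ _ _ _ wz) => // k u {wz}w -> eku.
  apply: contrapT => wc; apply: no; exists k, w; split=> // j wj.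
  by rewrite wj in eku wc; apply: wc; exact: chord.
pose x j k := if k == 1 then z else c (j + (k - 2)).
have lm1 : l = m - 1.
  apply: contrapT => lneq; pose x' k := c k.-1.
  have x'inj k k' : 0 < k <= m -> 0 < k' <= m -> x' k = x' k' -> k = k'.
    by move=> km km' /cinj; rewrite !modn_small; lia.
  by have [k _ /esym/zC] := label_surj z cardT x'inj.
have xinj j k k' : 0 < k <= m -> 0 < k' <= m -> x j k = x j k' -> k = k'.
  rewrite /x; case: eqP => [->|k1]; case: eqP => [->|k1'] //.
  - by move=> _ _ /zC.
  - by move=> _ _ /esym/zC.
  move=> km km' /cinj /eqP; rewrite eqn_modDl => /eqP.
  by rewrite !modn_small; lia.
have [j ezj] : exists j, e z (c j).
  have [u ezu] := out z; have [k _ uE] := label_surj u cardT (xinj 0).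
  move: uE ezu; rewrite /x; case: eqP => [_ <- ezz|_ <-]; last by exists (0 + (k - 2)).
  suff : l <= 1 by lia.
  apply: (minl (t + i %% l + 1) z) => //; last exact: walk1.
  exact: walk_cat (reach i) (walk1 eiz).
have x1 : x j 1 = z by [].
have xE k : 1 < k -> x j k = c (j + (k - 2)) by rewrite /x; case: eqP => // ->.
apply: (classify_long m_ge4 cardT aperiodic (x := x j)); first exact: xinj.
- move=> k km; have [->|k1] := eqVneq k 1; first by rewrite x1 xE // addn0.
  by rewrite !xE; [|lia|lia]; rewrite subSn ?addnS //; lia.
- rewrite !xE //; last by lia.
  rewrite subnn addn0 -(cmod (j + (m - 2)).+1 j) //.
  by rewrite -addnS (_ : (m - 2).+1 = l) ?modnDr //; lia.
- move=> k l' km l'0; rewrite -lm1; have [->|k1] := eqVneq k 1; last first.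
    by rewrite xE; [exact: minl (reach _) l'0 | lia].
  by apply: minl l'0; exact: walk_cat (reach i) (walk1 eiz).
Qed.

Lemma slow_digraphs y d : 3 <= d ->
  (forall k l z, walk e k y z -> 0 < l -> walk e l z z ->
     (d - 1) * (m - 2) + 1 < (d - 1) * l + k) ->
  (given_by e m (F1 m) \/ given_by e m (F2 m)) \/
  (exists D, listed_digraph m D /\ given_by e m D) /\
  exists z, walk e 2 y z /\ walk e (m - 2) z z.
Proof.
move=> d3 slow.
have [p [t [l [p0 [l0 ptl] parc pinj minl]]]] := shortest_lasso y out.
have tlm : t + l <= m.
  rewrite -cardT -[t + l]card_ord; apply: (@leq_card _ _ (fun i : 'I_ _ => p i)).
  by move=> i j /pinj ij; apply: val_inj; apply: ij.
have reach i : i <= t + l -> walk e i y (p i).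
  by move=> il; rewrite -p0 -{1}(subn0 i); apply: walk_fun => // k ki; apply: parc; lia.
have circuit : walk e l (p t) (p t).
  have := @walk_fun _ e p t (t + l); rewrite addKn ptl; apply; first exact: leq_addr.
  by move=> k /andP [_]; exact: parc.
have yt : walk e t y (p t) by apply: reach; lia.
have := slow _ _ _ yt l0 circuit.
have [lm1|] := leqP (m - 1) l.
  by left; exact: (long_lasso p0 lm1 ptl tlm parc pinj minl).
move=> lm slow_t; right.
(* With [s = m - 2 - l], the hypothesis gives [(d - 1) * s + 1 < t <= s + 2]; as [d >= 3], this
   forces [s = 0] and [t = 2]. *)
have ml : (d - 1) * (m - 2) = (d - 1) * l + (d - 1) * (m - 2 - l).
  by rewrite -mulnDr subnKC //; lia.
have dl : 2 * (m - 2 - l) <= (d - 1) * (m - 2 - l) by rewrite leq_mul2r; lia.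
have [lE tE] : l = m - 2 /\ t = 2 by lia.
split; last by exists (p t); rewrite -lE -{1}tE.
have tl : t + l = m by lia.
rewrite tl in parc pinj reach.
apply: (classify_short m_ge4 cardT aperiodic (x := fun i => p (i - 1))).
- by move=> i j im jm /pinj; lia.
- by move=> [//|i] im; rewrite !subn1 /=; apply: parc; lia.
- have -> : p (3 - 1) = p (m - 1).+1.
    by rewrite (_ : (m - 1).+1 = t + l) ?ptl ?tE; [|lia].
  by apply: parc; lia.
- move=> i l' im l'0; rewrite -lE; apply: minl => //.
  by apply: reach; lia.
- move=> k i l' k1 im l'0; rewrite subnn p0 => yi ii.
  have := slow _ _ _ yi l'0 ii; case: (leqP (m - 1) l') => // l'm.
  have : (d - 1) * l' <= (d - 1) * (m - 2) by rewrite leq_mul2l; lia.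
  lia.
Qed.

End DigraphTheorem.

(** * The digraph of a primitive matrix *)

Section RayDigraph.
Set Implicit Arguments.
Unset Strict Implicit.
Import Order.TTheory GRing.Theory Num.Theory.
Import numFieldNormedType.Exports.
Variables (R : realType) (m n : nat) (K : set 'cV[R]_n.+1) (A : 'M[R]_n.+1).
Implicit Types (x y z u : 'cV[R]_n.+1) (t c : R) (s : seq 'cV[R]_n.+1).
Implicit Types (D : seq (nat * nat)).
Hypothesis properK : proper_cone K.
Hypothesis primA : primitive K A.
Hypothesis m_ge4 : (4 <= m)%N.

Variable v : 'I_m -> 'cV[R]_n.+1.
Hypothesis extv : forall i, extreme_vector K (v i).
Hypothesis v_surj :
  forall x, extreme_vector K x -> exists i c, 0 < c /\ x = c *: v i.
Hypothesis v_inj : forall i j, dominated K (v i) (v j) -> i = j.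

Let coneK : convex_cone K. Proof. by case: properK. Qed.
Let d := degree_mxminpoly A.
Let Kv i : K (v i). Proof. by case: (extv i). Qed.
Let v_neq0 i : v i != 0. Proof. by case: (extv i). Qed.

Lemma ray_not_interior i : ~ K° (v i).
Proof.
move=> Ivi; have ij j : i = j by apply: v_inj; exact: (interior_dominated coneK).
have m0 : (0 < m)%N by exact: leq_trans m_ge4.
have m1 : (1 < m)%N by exact: leq_trans m_ge4.
by have := ij (Ordinal m0); rewrite (ij (Ordinal m1)) => /(congr1 val).
Qed.

(** The summands given by [Minkowski] are grouped by ray. Removing the term of [v i] leaves a vector
    of [K], whence the domination. *)
Lemma ray_decomposition x : K x -> exists c : 'I_m -> R,
  [/\ x = \sum_i c i *: v i, forall i, 0 <= c i
    & forall i, c i != 0 -> dominated K x (v i)].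
Proof.
move=> Kx; have [c xE c0] : exists2 c : 'I_m -> R, x = \sum_i c i *: v i &
    forall i, 0 <= c i.
  have [s -> exts] := Minkowski properK Kx.
  elim: s exts => [|w s IHs] exts.
    by exists (fun=> 0) => //; rewrite big_nil big1 // => i _; rewrite scale0r.
  have [|c sE c0] := IHs; first by move=> u us; apply: exts; rewrite in_cons us orbT.
  have [i [a [a0 wE]]] := v_surj (exts w (mem_head _ _)).
  exists (fun j => (if j == i then a else 0) + c j); last first.
    by move=> j; apply: addr_ge0 => //; case: ifP => // _; exact: ltW.
  rewrite big_cons sE wE.
  under [RHS]eq_bigr do rewrite scalerDl.
  rewrite big_split /=; congr (_ + _); rewrite (bigD1 i) //= eqxx big1 ?addr0 //.
  by move=> j /negbTE ->; rewrite scale0r.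
exists c; split=> // i ci.
exists (c i)^-1; first by rewrite invr_gt0 lt_neqAle eq_sym ci c0.
rewrite xE (bigD1 i) //= scalerDr scalerK // addrAC subrr add0r.
apply: (coneZ coneK); first by rewrite invr_ge0.
by apply: (big_ind K); [exact: cone0|exact: coneD|move=> j _; exact: (coneZ coneK)].
Qed.

Definition ray_rel : rel 'I_m := fun i j => `[< dominated K (A *m v i) (v j) >].

Let KA x : K x -> K (A *m x). Proof. exact: primA.1. Qed.

Lemma walk_dominated l i j : walk ray_rel l i j -> dominated K (A ^+ l *m v i) (v j).
Proof.
elim: l i => [|l IHl] i /=.
  by move=> ->; rewrite expr0 mul1mx; exact: dominated_refl.
move=> [k /asboolP ik /IHl kj]; apply: (dominated_trans coneK) kj.
by rewrite exprSr -mulmxA; apply: (dominated_expmx primA) => //; exact: KA.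
Qed.

(** This is the converse of [walk_dominated]: [A ^+ l *m v i] is a nonnegative combination of the
    [v j] at the ends of the walks of length [l] from [i]. *)
Lemma dominated_walk l i u : K u ->
  (forall j, walk ray_rel l i j -> dominated K u (v j)) ->
  dominated K u (A ^+ l *m v i).
Proof.
move=> Ku; elim: l i => [|l IHl] i Hu; first by rewrite expr0 mul1mx; exact: Hu.
have [c [AE c0 dc]] := ray_decomposition (KA (Kv i)).
rewrite exprSr -mulmxA AE mulmx_sumr.
apply: (big_ind (dominated K u)) => [|x y|j _]; first exact: dominated0.
- exact: (dominatedDr coneK).
rewrite -scalemxAr; have [->|cj] := eqVneq (c j) 0.
  by rewrite scale0r; exact: dominated0.
apply: (dominatedZr coneK) => //; apply: IHl => k jk; apply: Hu; exists j => //.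
exact/asboolP/dc.
Qed.

Lemma ray_rel_out i : exists j, ray_rel i j.
Proof.
have [c [AE c0 dc]] := ray_decomposition (KA (Kv i)).
apply: contrapT => no; have := mulmx_neq0 properK primA (Kv i) (v_neq0 i).
rewrite AE big1 ?eqxx // => j _; have [->|cj] := eqVneq (c j) 0.
  by rewrite scale0r.
by case: no; exists j; apply/asboolP; exact: dc.
Qed.

(** Otherwise [v i], a boundary vector, would dominate [A ^+ l *m v i]. *)
Lemma ray_rel_aperiodic i l : (0 < l)%N -> ~ forall j, walk ray_rel l i j -> j = i.
Proof.
move=> l0 H.
have := not_dominated_pow properK primA (Kv i) (v_neq0 i) (@ray_not_interior i) l0.
apply; apply: dominated_walk => // j /H ->; exact: dominated_refl.
Qed.

Lemma slow_ray N : (0 < N < gamma K A)%N -> exists i, forall k l j,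
  walk ray_rel k i j -> (0 < l)%N -> walk ray_rel l j j -> (N < (d - 1) * l + k)%N.
Proof.
move=> /(lt_gamma properK primA) [x [extx INx]].
have [i [c [c0 xE]]] := v_surj extx; exists i => k l j ij l0 jj.
rewrite ltnNge; apply/negP => le_N; apply: INx.
rewrite xE -scalemxAr; apply: (interiorZ coneK) => //.
apply: (interior_expmxW properK primA) le_N _.
have Ij := interior_cycle properK primA (Kv j) (v_neq0 j) l0 (walk_dominated jj).
apply: (dominated_interior coneK Ij); rewrite exprD -mulmxA.
apply: (dominated_expmx primA); first exact: cone_expmx.
exact: walk_dominated.
Qed.

Lemma ray_arcP i j : ray_arc K A (Phi K (v i)) (Phi K (v j)) <-> ray_rel i j.
Proof.
have Phi_eq x y : K x -> Phi K x = Phi K y -> K y -> dominated K x y.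
  by move=> Kx xy Ky; apply/(sub_Phi coneK) => //; rewrite xy.
split=> [[x [y [extx exty ix jy xy]]]|/asboolP ij].
  have [Kx _ _] := extx; have [Ky _ _] := exty; apply/asboolP.
  apply: (@dominated_trans _ _ _ coneK (A *m x)).
    by apply: (@dominated_expmx _ _ _ _ primA 1) => //; exact: Phi_eq.
  apply: (@dominated_trans _ _ _ coneK y); last exact: Phi_eq (esym jy) _.
  by apply/(sub_Phi coneK) => //; exact: KA.
exists (v i), (v j); split=> //.
by apply/(sub_Phi coneK) => //; exact: KA.
Qed.

Lemma given_digraph D : given_by ray_rel m D -> digraph_given_by m K A D.
Proof.
move=> [x [xinj xsurj xarc]]; exists (fun i => Phi K (v (x i.+1))); split.
  split.
  - by move=> i _; exists (v (x i.+1)).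
  - move=> i j _ _ ij; apply: val_inj; apply: succn_inj.
    apply: xinj => /=; rewrite ?ltn_ord //.
    by apply: v_inj; apply/(sub_Phi coneK) => //; rewrite ij.
  - move=> _ [y exty <-]; have [i [c [c0 yE]]] := v_surj exty.
    have [k km kE] := xsurj i; have km' : (k.-1 < m)%N by lia.
    exists (Ordinal km') => //=; rewrite prednK; last by lia.
    by rewrite kE yE (PhiZ coneK).
by move=> i j; rewrite -xarc /= ?ltn_ord //; exact: ray_arcP.
Qed.

(** The Krylov space of [x0], that is, the least [A]-invariant subspace containing it. *)
Definition cyclic_span x0 : set 'cV[R]_n.+1 :=
  [set u | exists q : {poly R}, u = horner_mx A q *m x0].

Lemma cyclic_spanD x0 x y : cyclic_span x0 x -> cyclic_span x0 y ->
  cyclic_span x0 (x + y).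
Proof.
by move=> [p ->] [q ->]; exists (p + q); rewrite rmorphD mulmxDl.
Qed.

Lemma cyclic_spanZ x0 c x : cyclic_span x0 x -> cyclic_span x0 (c *: x).
Proof.
by move=> [p ->]; exists (c *: p); rewrite linearZ -scalemxAl.
Qed.

Lemma cyclic_span_mulmx x0 x : cyclic_span x0 x -> cyclic_span x0 (A *m x).
Proof.
by move=> [p ->]; exists ('X * p); rewrite rmorphM /= horner_mx_X mulmxA.
Qed.

Lemma cyclic_span_refl x0 : cyclic_span x0 x0.
Proof. by exists 1; rewrite rmorph1 mul1mx. Qed.

(** As [K] has nonempty interior, its rays span the space. So the vectors [A ^+ i *m x0] span it,
    and those with [i < d] suffice. *)
Lemma cyclic_degree x0 : (forall i, cyclic_span x0 (v i)) -> d = n.+1.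
Proof.
move=> Sv; have SK x : K x -> cyclic_span x0 x.
  move=> /ray_decomposition [c [-> _ _]].
  apply: (big_ind (cyclic_span x0)) => [||i _]; last exact: cyclic_spanZ.
  - by exists 0; rewrite rmorph0 mul0mx.
  - exact: cyclic_spanD.
have spanT u : cyclic_span x0 u.
  have [_ _ _ [w Iw]] := properK.
  have [e e0 He] := near_line u Iw; have e2 : 0 < e / 2 by rewrite divr_gt0.
  have -> : u = (e / 2)^-1 *: ((w + (e / 2) *: u) + (- 1) *: w).
    by rewrite scaleN1r addrAC subrr add0r scalerK // gt_eqF.
  apply: cyclic_spanZ; apply: cyclic_spanD; last first.
    by apply/cyclic_spanZ/SK; exact: interior_subset.
  by apply/SK/He; rewrite gtr0_norm // ltr_pdivrMr // ltr_pMr // ltr1n.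
suff : (n.+1 <= d)%N by have := degree_mxminpoly_le A; rewrite -/d; lia.
pose M := \matrix_(i < d) (A ^+ i *m x0)^T.
apply: leq_trans (rank_leq_row M); rewrite -[X in (X <= _)%N](mxrank1 R).
apply/mxrankS/row_subP => i; rewrite -[row _ _]trmxK.
have [q ->] := spanT (row i 1%:M)^T.
have [c ->] := horner_mx_comb A q; rewrite mulmx_suml linear_sum.
apply: summx_sub => j _; rewrite -scalemxAl linearZ.
apply: scalemx_sub.
by rewrite -[X in (X <= _)%MS](rowK (fun j => (A ^+ j *m x0)^T)) row_sub.
Qed.

(** The coefficient of [v j] in [A *m v i] is nonzero, since otherwise [v k] would dominate [v j];
    so [v j] can be solved for. *)
Lemma cyclic_step x0 i j k : ray_rel i j -> j != k ->
  (forall l, ray_rel i l -> l = j \/ l = k) ->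
  cyclic_span x0 (v i) -> cyclic_span x0 (v k) -> cyclic_span x0 (v j).
Proof.
move=> /asboolP ij jk out Si Sk.
have [c [AE c0 dc]] := ray_decomposition (KA (Kv i)).
have {}AE : A *m v i = c j *: v j + c k *: v k.
  rewrite AE (bigD1 j) //= (bigD1 k) 1?eq_sym //= big1 ?addr0 // => l.
  move=> /andP [lj lk]; have [->|cl] := eqVneq (c l) 0; first by rewrite scale0r.
  have [lE|lE] := out l (asboolT (dc l cl)); first by rewrite lE eqxx in lj.
  by rewrite lE eqxx in lk.
have cj : c j != 0.
  apply/eqP => cj; rewrite cj scale0r add0r in AE.
  have ck : 0 < c k.
    rewrite lt_neqAle c0 andbT eq_sym; apply/eqP => ck.
    have := mulmx_neq0 properK primA (Kv i) (v_neq0 i).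
    by rewrite AE ck scale0r eqxx.
  case/eqP: jk; apply/esym/v_inj.
  rewrite -[v k](scalerK (lt0r_neq0 ck)) -AE.
  by apply: dominatedZl => //; rewrite invr_gt0.
have -> : v j = (c j)^-1 *: (A *m v i + (- c k) *: v k).
  by rewrite AE scaleNr addrK scalerK.
by apply/cyclic_spanZ/cyclic_spanD; [exact: cyclic_span_mulmx|exact: cyclic_spanZ].
Qed.

End RayDigraph.

(** * Bounds on the exponent from the ray digraph *)

Section Exponent.
Set Implicit Arguments.
Unset Strict Implicit.
Import Order.TTheory GRing.Theory Num.Theory.
Variables (R : realType) (m n : nat) (K : set 'cV[R]_n.+1) (A : 'M[R]_n.+1).
Hypothesis properK : proper_cone K.
Hypothesis primA : primitive K A.
Hypothesis m_ge4 : (4 <= m)%N.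
Variable v : 'I_m -> 'cV[R]_n.+1.
Hypothesis extv : forall i, extreme_vector K (v i).
Hypothesis v_surj :
  forall x, extreme_vector K x -> exists i c, 0 < c /\ x = c *: v i.
Hypothesis v_inj : forall i j, dominated K (v i) (v j) -> i = j.
Let d := degree_mxminpoly A.
Let e := ray_rel K A v.
Local Open Scope nat_scope.

Let step := cyclic_step properK primA extv v_surj v_inj.
Let degree := @cyclic_degree _ _ _ _ A properK m_ge4 _ extv v_surj.

Lemma degree_F1 : given_by e m (F1 m) -> d = n.+1.
Proof.
move=> [x [xinj xsurj xarc]]; apply: (@degree (v (x 1))) => i.
have [k km <-] := xsurj i; elim: k km => [|k IHk] // km.
have [->|k0] := eqVneq k 0; first exact: cyclic_span_refl.
(* Here [x k.+1] is the only out-neighbour of [x k]; [x 1] merely fills the place of a second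
   one. *)
apply: (@step _ (x k) _ (x 1)).
- by rewrite -/e xarc; [decide_arcs; lia|lia|lia].
- by apply/eqP => /xinj; lia.
- move=> w; have [j jm <-] := xsurj w; rewrite -/e xarc //; last lia.
  by decide_arcs => ej; left; congr x; lia.
- by apply: IHk; lia.
- exact: cyclic_span_refl.
Qed.

(** The start is [x 2], as [x 1] has two out-neighbours. The path yields [x 3, ..., x m], and [x 1]
    comes last, through [x m], whose other out-neighbour is [x 2]. *)
Lemma degree_F2 : given_by e m (F2 m) -> d = n.+1.
Proof.
move=> [x [xinj xsurj xarc]].
have span2 k : 2 <= k <= m -> cyclic_span A (v (x 2)) (v (x k)).
  elim: k => [|k IHk] // km.
  have [->|k0] := eqVneq k 1; first exact: cyclic_span_refl.
  apply: (@step _ (x k) _ (x 2)).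
  - by rewrite -/e xarc; [decide_arcs; lia|lia|lia].
  - by apply/eqP => /xinj; lia.
  - move=> w; have [j jm <-] := xsurj w; rewrite -/e xarc //; last lia.
    by decide_arcs => ej; have [->|->] : j = k.+1 \/ j = 2 by [lia]; [left|right].
  - by apply: IHk; lia.
  - exact: cyclic_span_refl.
apply: (@degree (v (x 2))) => i.
have [k km <-] := xsurj i; have [k2|k1] := leqP 2 k; first by apply: span2; lia.
have -> : k = 1 by lia.
apply: (@step _ (x m) _ (x 2)).
- by rewrite -/e xarc; [decide_arcs; lia|lia|lia].
- by apply/eqP => /xinj; lia.
- move=> w; have [j jm <-] := xsurj w; rewrite -/e xarc //; last lia.
  by decide_arcs => ej; have [->|->] : j = 1 \/ j = 2 by [lia]; [left|right].
- by apply: span2; lia.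
- exact: cyclic_span_refl.
Qed.

Lemma cycle_F x (D : seq (nat * nat)) : 
  (forall i j, 0 < i <= m -> 0 < j <= m -> e (x i) (x j) = ((i, j) \in D)) ->
  {subset F1 m <= D} -> forall i, 2 <= i <= m -> walk e (m - 1) (x i) (x i).
Proof.
move=> xarc sub i im.
have xpath k : 0 < k < m -> e (x k) (x k.+1).
  by move=> km; rewrite xarc; [apply: sub; decide_arcs; lia|lia|lia].
have fw := forward_walk xpath.
have -> : m - 1 = m - i + (1 + (i - 2)) by lia.
apply: (walk_cat (fw i m _ _)); [lia|lia|].
apply: (walk_cat (walk1 (b := x 2) _)); last by apply: fw; lia.
by rewrite xarc; [apply: sub; decide_arcs; lia|lia|lia].
Qed.

(** The vertex [x 1] takes one step to reach the circuit; this is the summand 1 in the bound for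
    [F1]. *)
Lemma near_cycle_F1 y : given_by e m (F1 m) ->
  exists k z, [/\ k <= 1, walk e k y z & walk e (m - 1) z z].
Proof.
move=> [x [xinj xsurj xarc]]; have cyc := cycle_F xarc (fun _ H => H).
have [k km <-] := xsurj y; have [k2|k1] := leqP 2 k.
  by exists 0, (x k); split=> //; apply: cyc; lia.
have -> : k = 1 by lia.
exists 1, (x 2); split=> //; last by apply: cyc; lia.
by apply: walk1; rewrite xarc; [decide_arcs; lia|lia|lia].
Qed.

(** Through the arc [x 1 -> x 3] even [x 1] lies on a closed walk of length [m - 1], so the bound
    for [F2] lacks the summand 1. *)
Lemma cycle_F2 y : given_by e m (F2 m) -> walk e (m - 1) y y.
Proof.
move=> [x [xinj xsurj xarc]].
have cyc : forall i, 2 <= i <= m -> walk e (m - 1) (x i) (x i).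
  by apply: cycle_F xarc _ => q qF; rewrite /F2 mem_cat qF.
have [k km <-] := xsurj y; have [k2|k1] := leqP 2 k; first by apply: cyc; lia.
have xpath i : 0 < i < m -> e (x i) (x i.+1).
  by move=> im; rewrite xarc; [decide_arcs; lia|lia|lia].
have -> : k = 1 by lia.
have -> : m - 1 = 1 + (m - 3 + 1) by lia.
apply: (walk_cat (walk1 (b := x 3) _)).
  by rewrite xarc; [decide_arcs; lia|lia|lia].
apply: (walk_cat (forward_walk xpath _ _)); [lia|lia|].
by apply: walk1; rewrite xarc; [decide_arcs; lia|lia|lia].
Qed.

Let slow N : 3 <= d -> (d - 1) * (m - 2) + 1 <= N < gamma K A ->
  exists y, (forall k l z, walk e k y z -> 0 < l -> walk e l z z ->
      N < (d - 1) * l + k) /\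
    ((given_by e m (F1 m) \/ given_by e m (F2 m)) \/
     (exists D, listed_digraph m D /\ given_by e m D) /\
     exists z, walk e 2 y z /\ walk e (m - 2) z z).
Proof.
move=> d3 /andP [leN ltN].
have [|y slow_y] := slow_ray properK primA extv v_surj (N := N).
  by rewrite ltN andbT; apply: leq_trans leN; rewrite addn1.
exists y; split; first exact: slow_y.
apply: (slow_digraphs m_ge4 (card_ord m) _ _ d3).
- exact: ray_rel_aperiodic.
- exact: ray_rel_out.
- by move=> k l z yz l0 zz; apply: leq_ltn_trans leN (slow_y _ _ _ yz l0 zz).
Qed.

Lemma listed_of_slow : 3 <= d -> (d - 1) * (m - 2) + 1 < gamma K A ->
  exists D, listed_digraph m D /\ given_by e m D.
Proof.
move=> d3 lt; have [|y [_ [[FD|FD]|[]//]]] := slow d3 (N := (d - 1) * (m - 2) + 1).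
- by rewrite leqnn.
- by exists (F1 m); split=> //; left; rewrite !inE eqxx.
- by exists (F2 m); split=> //; left; rewrite !inE eqxx !orbT.
Qed.

(** From this threshold on, a closed walk of length [m - 2] at distance 2 is already too fast, which
    leaves the two digraphs with circuits of length [m - 1]. *)
Lemma F1_or_F2_of_slow N : 3 <= d -> (d - 1) * (m - 2) + 2 <= N < gamma K A ->
  given_by e m (F1 m) /\ N < (d - 1) * (m - 1) + 1 \/
  given_by e m (F2 m) /\ N < (d - 1) * (m - 1).
Proof.
move=> d3 /andP [leN ltN].
have [|y [slow_y [[FD|FD]|[_ [z [yz zz]]]]]] := slow d3 (N := N).
- by rewrite ltN andbT; lia.
- left; split=> //; have [k [z [k1 yz zz]]] := near_cycle_F1 y FD.
  have m1 : 0 < m - 1 by lia.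
  by have := slow_y _ _ _ yz m1 zz; lia.
- right; split=> //; have m1 : 0 < m - 1 by lia.
  by have := slow_y 0 _ y erefl m1 (cycle_F2 y FD); rewrite addn0.
- have m2 : 0 < m - 2 by lia.
  by have := slow_y _ _ _ yz m2 zz; lia.
Qed.

End Exponent.

(** * Representatives of the extreme rays *)

Section Rays.
Import Order.TTheory GRing.Theory Num.Theory.

Lemma polyhedral_cone_rays (R : realType) (m n : nat) (K : set 'cV[R]_n) :
  polyhedral_cone m K -> exists v : 'I_m -> 'cV[R]_n,
  [/\ forall i, extreme_vector K (v i),
      forall x, extreme_vector K x -> exists i c, 0 < c /\ x = c *: v i
    & forall i j, dominated K (v i) (v j) -> i = j].
Proof.
move=> [properK cardE]; have coneK : convex_cone K by case: properK.
have /card_set_bijP [f [fE finj fsurj]] : ([set: 'I_m] #= extreme_rays K)%card.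
  by rewrite card_eq_sym; apply: card_eq_trans cardE card_II.
have /choice [v vP] : forall i, exists x, extreme_vector K x /\ Phi K x = f i.
  by move=> i; have [x extx xE] := fE i Logic.I; exists x.
have Kv i : K (v i) by case: (vP i) => -[].
have vK i j : dominated K (v i) (v j) -> i = j.
  move=> ij; apply: finj; rewrite ?inE //.
  have [[_ vj0 _] <-] := vP j; rewrite -(vP i).2.
  have [c c0 ->] := extreme_dominated properK (vP i).1 (Kv j) ij vj0.
  by rewrite (PhiZ coneK).
exists v; split=> // [i|x extx]; first exact: (vP i).1.
have [i _ iE] : [set f i | i in [set: 'I_m]] (Phi K x) by apply: fsurj; exists x.
have [Kx x0 _] := extx; have vx : dominated K (v i) x.
  by apply/(sub_Phi coneK) => //; rewrite (vP i).2 iE.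
have [c c0 xE] := extreme_dominated properK (vP i).1 Kx vx x0.
by exists i, c.
Qed.

End Rays.

(* The dimension is n.+1: degree_mxminpoly is only defined for square matrices
   of successor size. *)
Theorem theorem4p4 (R : realType) (m n : nat)
    (hm : (4 <= m)%N) (hn : (3 <= n.+1 <= m)%N)
    (K : set 'cV[R]_n.+1) (hK : polyhedral_cone m K)
    (A : 'M[R]_n.+1) (hA : primitive K A) :
  let mA := degree_mxminpoly A in
  let g := gamma K A in
  [/\ (* (i) *)
      (g <= (mA - 1) * (m - 1) + 1)%N /\
      (g = ((mA - 1) * (m - 1) + 1)%N ->
        digraph_given_by m K A (F1 m) /\
        g = ((n.+1 - 1) * (m - 1) + 1)%N),
      (* (ii) *)
      g = ((mA - 1) * (m - 1))%N ->
        ((digraph_given_by m K A (F1 m) \/ digraph_given_by m K A (F2 m)) /\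
         g = ((n.+1 - 1) * (m - 1))%N) \/
        mA = 3%N,
      (* (iii) *)
      g = ((mA - 1) * (m - 2) + 2)%N ->
        (3 <= mA)%N /\
        exists D, listed_digraph m D /\ digraph_given_by m K A D
    & (* (iv) *)
      mA = 2%N \/ ~ (exists D, listed_digraph m D /\ digraph_given_by m K A D) ->
        (g <= (mA - 1) * (m - 2) + 1)%N ].
Proof.
move=> mA g; have [properK _] := hK.
have [v [extv v_surj v_inj]] := polyhedral_cone_rays hK.
have given D := @given_digraph _ _ _ _ _ properK hA hm _ extv v_surj v_inj D.
have m0 : (0 < m)%N by lia.
pose i0 := Ordinal m0.
have [Kv0 v0 _] := extv i0; have bd0 := @ray_not_interior _ _ _ _ properK hm _ v_inj i0.
have mA_gt1 : (1 < mA)%N := degree_gt1 properK hA Kv0 v0 bd0.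
have [mA2|mA_neq2] := eqVneq mA 2%N.
  have g2 : (g <= 2)%N.
    exact/(gammaP hA).2/(degree2_power_positive properK hA Kv0 v0 bd0).
  (* Every equality in the statement would now ask for [g >= m - 1 >= 3]. *)
  by rewrite mA2; split; [split|..]; lia.
have mA3 : (3 <= mA)%N by lia.
have slow N : ((mA - 1) * (m - 2) + 2 <= N < g)%N ->
    given_by (ray_rel K A v) m (F1 m) /\ (N < (mA - 1) * (m - 1) + 1)%N \/
    given_by (ray_rel K A v) m (F2 m) /\ (N < (mA - 1) * (m - 1))%N.
  exact: F1_or_F2_of_slow.
have listed : ((mA - 1) * (m - 2) + 1 < g)%N ->
    exists D, listed_digraph m D /\ digraph_given_by m K A D.
  move=> /(listed_of_slow properK hA hm extv v_surj v_inj mA3) [D [listD givD]].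
  by exists D; split=> //; exact: given.
have m12 : ((mA - 1) * (m - 1) = (mA - 1) * (m - 2) + (mA - 1))%N by nia.
have dF1 := degree_F1 properK hA hm extv v_surj v_inj.
have dF2 := degree_F2 properK hA hm extv v_surj v_inj.
split.
- split=> [|gE].
    rewrite leqNgt; apply/negP => g_gt.
    by have [|[_]|[_]] := slow ((mA - 1) * (m - 1) + 1)%N; lia.
  (* This is [g - 1], which equals the bound for [F2]; that bound is strict, so only [F1]
     remains. *)
  have [|[gF1 _]|[_]] := slow ((mA - 1) * (m - 1))%N; [lia | | lia].
  by split; [exact: given | rewrite gE /mA dF1].
- move=> gE; have [->|mA_neq3] := eqVneq mA 3%N; [by right | left].
  (* The value [g - 1] reaches the threshold of [slow] only for [mA >= 4], hence the alternative
     [mA = 3]. *)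
  have /slow [[gF _]|[gF _]] : ((mA - 1) * (m - 2) + 2 <= (mA - 1) * (m - 1) - 1 < g)%N.
    have mA4 : (4 <= mA)%N by lia.
    have g0 : (0 < g)%N by case: (gammaP hA).1.
    by rewrite gE m12 in g0 *; clear -g0 mA4; lia.
    by split; [left; exact: given | rewrite gE /mA dF1].
  by split; [right; exact: given | rewrite gE /mA dF2].
- by move=> gE; split=> //; apply: listed; lia.
- move=> [mA2|nlisted]; first by rewrite mA2 in mA_neq2.
  by rewrite leqNgt; apply/negP => /listed.
Qed.
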